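(* Let $\mathcal{N}$ be a continuous nest on a separable Hilbert space $\mathcal{H}$. Let $\Omega_1$ and $\Omega_2$ be stable nets of intervals of $\mathcal{N}$ and, for $k=1,2$, let $$\mathcal{I}_k = \Big\{ X\in\operatorname{Alg}\mathcal{N} : \lim_{P\in\Omega_k}\ \sup_{E\in P} \|EXE\|_{\mathrm{ess}} = 0 \Big\}.$$ Then $\mathcal{I}_1\supseteq\mathcal{I}_2$ if and only if $\Omega_1$ is cofinal in $\Omega_2$, that is, for every $Q\in\Omega_2$ there is a $P\in\Omega_1$ which refines $Q$.
   Context: A nest $\mathcal{N}$ is a strongly closed chain of orthogonal projections on $\mathcal{H}$ containing $0$ and $I$; it is continuous if it has no atoms (equivalently, it is order isomorphic to $[0,1]$). $\operatorname{Alg}\mathcal{N}$ is the algebra of all bounded operators $X$ on $\mathcal{H}$ with $XN=NXN$ for all $N\in\mathcal{N}$. $\|X\|_{\mathrm{ess}}$ is the essential norm, i.e. the distance from $X$ to the compact operators on $\mathcal{H}$. An interval of $\mathcal{N}$ is a projection $N-M$ with $M\le N$ in $\mathcal{N}$. Families of intervals are non-empty sets of intervals. If $P_1,P_2$ are families of intervals, $P_1$ refines $P_2$, written $P_1\ge P_2$, if for every $E\in P_1$ there is $F\in P_2$ with $E\le F$. A net of intervals is a set $\Omega$ of families of intervals that is directed under refinement. An order isomorphism $\theta:\mathcal{N}\to\mathcal{N}$ acts on intervals by $\theta(N-M)=\theta(N)-\theta(M)$ and on families by $\theta(P)=\{\theta(E):E\in P\}$. The net $\Omega$ is a stable net if $\theta(P)\in\Omega$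 for every $P\in\Omega$ and every order isomorphism $\theta$ of $\mathcal{N}$ onto itself. For fixed $X$, the map $P\mapsto\sup_{E\in P}\|EXE\|_{\mathrm{ess}}$ is decreasing with respect to refinement, so the limit over a net exists. *)

(* Defs.v *)
From HB Require Import structures.
From mathcomp Require Import all_boot all_order all_algebra.
From mathcomp Require Import all_classical all_reals all_analysis.
From mathcomp Require Import complex.

Set Implicit Arguments.
Unset Strict Implicit.
Unset Printing Implicit Defensive.

Import Order.TTheory GRing.Theory Num.Theory.
Import numFieldNormedType.Exports.

Local Open Scope classical_set_scope.
Local Open Scope ring_scope.
Local Open Scope complex_scope.

(* A complex Hilbert space is a complete normed space H over R[i] together with
   a positive definite hermitian form that induces its norm.  The form is
   linear in its first argument and conjugate-linear in its second. *)
Definition induces_norm (R : realType) (H : completeNormedModType R[i])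
    (dot : {dot H for Num.conj}) : Prop :=
  forall x : H, `|x| ^+ 2 = dot x x.

Definition separable (T : topologicalType) : Prop :=
  exists2 D : set T, countable D & dense D.

Section Operators.
Variables (R : realType) (H : completeNormedModType R[i]).
Implicit Types T K X : H -> H.

Definition bounded_operator T : Prop :=
  linear T /\ exists c : R[i], forall x, `|T x| <= c * `|x|.

(* Norms in H take values in R[i] (nonnegative reals there); Re brings them back
   to R, where suprema and infima are available. *)
Definition op_norm T : R :=
  sup [set complex.Re `|T x| | x in [set x : H | `|x| <= 1]].

Definition compact_operator K : Prop :=
  bounded_operator K /\ precompact (K @` [set x : H | `|x| <= 1]).

Definition ess_norm T : R :=
  inf [set op_norm (T \- K) | K in compact_operator].

(* The strong operator topology is the topology of pointwise convergence;
   closedness is relative to the bounded operators. *)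
Definition strongly_closed (A : set (H -> H)) : Prop :=
  forall T, bounded_operator T -> closure (A : set {ptws H -> H}) T -> A T.

End Operators.

Section Nests.
Variables (R : realType) (H : completeNormedModType R[i]).
Variable dot : {dot H for Num.conj}.
Implicit Types (E F M N X : H -> H) (NN P Q : set (H -> H)).
Implicit Types (Omega : set (set (H -> H))) (theta : (H -> H) -> (H -> H)).

Definition orth_projection E : Prop :=
  [/\ bounded_operator E, E \o E = E & forall x y, dot (E x) y = dot x (E y)].

(* The usual order of self-adjoint operators; the inequality in R[i] includes
   that both sides differ by a real number. *)
Definition op_le E F : Prop := forall x, dot (E x) x <= dot (F x) x.

Definition nest NN : Prop :=
  [/\ NN `<=` orth_projection,
      forall M N, NN M -> NN N -> op_le M N \/ op_le N M,
      NN \0, NN idfun & strongly_closed NN].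

Definition nest_interval NN E : Prop :=
  exists M N, [/\ NN M, NN N, op_le M N & E = N \- M].

Definition atom NN E : Prop :=
  [/\ nest_interval NN E, E <> \0 &
      forall F, nest_interval NN F -> op_le F E -> F = \0 \/ F = E].

Definition continuous_nest NN : Prop :=
  nest NN /\ forall E, ~ atom NN E.

Definition Alg NN : set (H -> H) :=
  [set X | bounded_operator X /\ forall N, NN N -> X \o N = N \o X \o N].

Definition interval_family NN P : Prop := P `<=` nest_interval NN /\ P !=set0.

Definition refines P Q : Prop :=
  forall E, P E -> exists2 F, Q F & op_le E F.

Definition interval_net NN Omega : Prop :=
  [/\ Omega `<=` interval_family NN, Omega !=set0 &
      forall P Q, Omega P -> Omega Q ->
        exists S, [/\ Omega S, refines S P & refines S Q]].

(* Only the values of theta on NN are relevant. *)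
Definition order_iso NN theta : Prop :=
  set_bij NN NN theta /\
  forall M N, NN M -> NN N -> (op_le M N <-> op_le (theta M) (theta N)).

(* theta (N - M) = theta N - theta M is well defined: a nonzero interval
   determines its endpoints, and if N - M = 0 then theta N - theta M = 0. *)
Definition act_family NN theta P : set (H -> H) :=
  [set E | exists M N, [/\ NN M, NN N, op_le M N, P (N \- M) &
                           E = theta N \- theta M]].

Definition stable_net NN Omega : Prop :=
  interval_net NN Omega /\
  forall theta P, order_iso NN theta -> Omega P -> Omega (act_family NN theta P).

(* The filter of tails of Omega, so that f @ net_filter Omega --> l is
   convergence of f along the net. *)
Definition net_filter Omega : set_system (set (H -> H)) :=
  filter_from Omega (fun P => [set Q | Omega Q /\ refines Q P]).

Definition sup_ess_norm X P : R :=
  sup [set ess_norm (E \o X \o E) | E in P].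

Definition net_ideal NN Omega : set (H -> H) :=
  [set X | Alg NN X /\ sup_ess_norm X @ net_filter Omega --> (0 : R)].

Definition cofinal_in Omega1 Omega2 : Prop :=
  forall Q, Omega2 Q -> exists2 P, Omega1 P & refines P Q.

End Nests.

(* Main.v *)
Require Import Defs.
From HB Require Import structures.
From mathcomp Require Import all_boot all_order all_algebra.
From mathcomp Require Import all_classical all_reals all_analysis.
From mathcomp Require Import complex.
From mathcomp Require Import lra zify ring.

Set Implicit Arguments.
Unset Strict Implicit.
Unset Printing Implicit Defensive.

Import Order.TTheory GRing.Theory Num.Theory.
Import numFieldNormedType.Exports.

Local Open Scope classical_set_scope.
Local Open Scope ring_scope.

(** If a family [Q] of [Omega2] is refined by no family of [Omega1], then every
    family of [Omega1] has a [Q]-bad interval, one that lies under no member of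
    [Q].  It suffices to find one operator [X] in the nest algebra such that
    [FXF] has finite rank for all [F] in some family of [Omega2], while [EXE]
    has essential norm at least 1 for every [Q]-bad [E].  Identify the nest with
    [[0, 1]].  The operator is a sum of rank one operators [a (x) b] with
    orthonormal [a], [b] supported over small intervals [(x, x')] on the left of
    [(y, y')]: such a term can only survive in [FXF] if [F] meets both intervals,
    and it acts as a partial isometry in [EXE] if [E] contains both.

    Uncountably many minimal bad intervals must be caught by countably many
    terms, and this is where stability of [Omega2] enters.  The interior points
    of the members of [Q] form an open set whose components [(u, v)] are handled
    separately.  A bad interval containing a point outside of that set is caught
    by rational terms.  In a component, finitely many order isomorphisms that
    fix the complement of the open set and expand or contract along a chain of
    points adapted to [Q] move every bad interval [(s, t)] with [u < s], [t < v]
    strictly into itself for at least one of them; so, after passing to a family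
    that refines these finitely many images of [Q], there is enough room for
    rational terms.  The bad intervals that reach an end of a component need one
    sequence of terms per end. *)

(** * Order isomorphisms of the unit interval *)

Section Depth.
Variable R : realType.
Implicit Types (A P N : set R) (x y e : R) (f : R -> R).

(** The distance from [x] to the complement of [A]. Below, [0] always lies outside of [A], so that
    the infimum is over a nonempty set. *)
Definition depth A x : R := inf [set `|x - y| | y in ~` A].

Lemma depth_has_inf A x : ~ A 0 -> has_inf [set `|x - y| | y in ~` A].
Proof.
by move=> A0; split; [exists `|x - 0|, 0 | exists 0 => _ [y _ <-]].
Qed.

Lemma depth_ge0 A x : ~ A 0 -> 0 <= depth A x.
Proof.
move=> A0; apply: lb_le_inf; first by case: (depth_has_inf x A0).
by move=> _ [y _ <-].
Qed.

Lemma depth_le A x y : ~ A 0 -> ~ A y -> depth A x <= `|x - y|.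
Proof.
by move=> A0 Ay; apply: ge_inf; [case: (depth_has_inf x A0) | exists y].
Qed.

Lemma depth_out A x : ~ A 0 -> ~ A x -> depth A x = 0.
Proof.
move=> A0 Ax; apply/eqP; rewrite eq_le depth_ge0 // andbT.
by rewrite (le_trans (depth_le x A0 Ax)) // subrr normr0.
Qed.

Lemma depth_lip A x y : ~ A 0 -> depth A x <= depth A y + `|x - y|.
Proof.
move=> A0; rewrite -lerBlDr; apply: lb_le_inf.
  by case: (depth_has_inf y A0).
move=> _ [z Az <-]; rewrite lerBlDr (le_trans (depth_le x A0 Az)) //.
by rewrite [leRHS]addrC ler_distD.
Qed.

Lemma depth_in A x a b : ~ A 0 -> a < x -> x < b ->
  (forall y, a < y -> y < b -> A y) -> 0 < depth A x.
Proof.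
move=> A0 ax xb abA; apply: (@lt_le_trans _ _ (Num.min (x - a) (b - x))).
  by rewrite lt_min !subr_gt0 ax xb.
apply: lb_le_inf; first by case: (depth_has_inf x A0).
move=> _ [z Az <-]; rewrite leNgt lt_min !ltr_norml; apply/negP.
by move=> /andP[/andP[h1 h2] /andP[h3 h4]]; apply: Az; apply: abA; lra.
Qed.

(* [depth A] is 1-Lipschitz, which makes [push P N] increasing; it moves the
   interior of [P] to the right and the interior of [N] to the left. *)
Definition push P N x : R := x + (depth P x - depth N x) / 4%:R.

(* Values outside of [[0, 1]] are unconstrained. *)
Definition unit_iso f := [/\ f 0 = 0, f 1 = 1,
  forall x y, 0 <= x -> y <= 1 -> x < y -> f x < f y &
  forall y, 0 <= y -> y <= 1 -> exists x, [/\ 0 <= x, x <= 1 & f x = y]].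

Lemma push_fix P N x : ~ P 0 -> ~ N 0 -> ~ P x -> ~ N x -> push P N x = x.
Proof.
by move=> P0 N0 Px Nx; rewrite /push !depth_out // subrr mul0r addr0.
Qed.

(** As [P] and [N] are disjoint, the depth of [N] vanishes at a point of [P], and only the positive
    term remains. *)
Lemma push_gt P N x a b : ~ P 0 -> ~ N 0 -> P `&` N `<=` set0 ->
  a < x -> x < b -> (forall y, a < y -> y < b -> P y) -> x < push P N x.
Proof.
move=> P0 N0 PN ax xb abP; have dP := depth_in P0 ax xb abP.
have Nx : ~ N x by move=> Nx; apply: (PN x); split=> //; exact: abP.
by rewrite /push (depth_out N0 Nx) subr0 ltrDl divr_gt0.
Qed.

Lemma push_lt P N x a b : ~ P 0 -> ~ N 0 -> P `&` N `<=` set0 ->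
  a < x -> x < b -> (forall y, a < y -> y < b -> N y) -> push P N x < x.
Proof.
move=> P0 N0 PN ax xb abN; have dN := depth_in N0 ax xb abN.
have Px : ~ P x by move=> Px; apply: (PN x); split=> //; exact: abN.
rewrite /push (depth_out P0 Px) sub0r; lra.
Qed.

Lemma push_dist P N x y : ~ P 0 -> ~ N 0 ->
  `|push P N x - push P N y| <= 2%:R * `|x - y|.
Proof.
move=> P0 N0.
have := depth_lip x y P0; have := depth_lip y x P0.
have := depth_lip x y N0; have := depth_lip y x N0.
rewrite /push (distrC y x).
have := ler_norm (x - y); have := ler_norm (y - x); rewrite (distrC y x).
move: (depth P x) (depth P y) (depth N x) (depth N y) `|x - y| => a b c d n.
by move=> *; rewrite ler_norml; apply/andP; split; lra.
Qed.

(** The added term is Lipschitz with constant 1/2, so the sum with [x] is still strictly increasing;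
    surjectivity is the intermediate value theorem. *)
Lemma push_iso P N : ~ P 0 -> ~ N 0 -> ~ P 1 -> ~ N 1 -> unit_iso (push P N).
Proof.
move=> P0 N0 P1 N1; have f0 : push P N 0 = 0 by exact: push_fix.
have f1 : push P N 1 = 1 by exact: push_fix.
split=> // [x y _ _ xy|y y0 y1].
  have := depth_lip x y P0; have := depth_lip y x N0.
  rewrite (distrC y x) ltr0_norm ?subr_lt0 // /push.
  by move: (depth P x) (depth P y) (depth N x) (depth N y) => *; lra.
have cf : {within `[0, 1], continuous (push P N)}.
  apply: continuous_subspaceT => x; apply/cvgrPdist_lt => e e0; near=> z.
  apply: (le_lt_trans (push_dist _ _ P0 N0)).
  rewrite mulrC -ltr_pdivlMr //; near: z.
  have : 0 < e / 2%:R by lra.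
  by move: (e / 2%:R) => d d0; apply/nbhs_ballP; exists d.
have [|x] := @IVT _ _ 0 1 y ler01 cf.
  by rewrite f0 f1 minEle maxEle ler01 y0.
by rewrite in_itv /= => /andP[x0 x1] <-; exists x.
Unshelve. all: by end_near.
Qed.

End Depth.

(** * Intervals and components *)

Section Components.
Variable R : realType.
Implicit Types (Q : R -> R -> Prop) (f : R -> R) (a b p q s t u v x y z : R).

Definition subunit Q := forall a b, Q a b -> [/\ 0 <= a, a <= b & b <= 1].

Definition fits Q s t := exists a b, [/\ Q a b, a <= s & t <= b].

(** For [p = q = z] this says that [z] is an interior point of a member. The case [q < p] is allowed
    and occurs in [chain_ex]. *)
Definition fits_inside Q p q := exists a b, [/\ Q a b, a < p & q < b].

Definition image_intervals f Q a b :=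
  exists a0 b0, [/\ Q a0 b0, a = f a0 & b = f b0].

(** A connected component of the open set of points interior to some member of [Q]. *)
Definition component Q u v := [/\ ~ fits_inside Q u u, ~ fits_inside Q v v,
  u < v & forall z, u < z -> z < v -> fits_inside Q z z].

Lemma fits_insideW Q p q p' q' :
  p <= p' -> q' <= q -> fits_inside Q p q -> fits_inside Q p' q'.
Proof. by move=> pp qq [a [b [Qab ap qb]]]; exists a, b; split=> //; lra. Qed.

Lemma fits_inside_fits Q p q : fits_inside Q p q -> fits Q p q.
Proof. by move=> [a [b [Qab ap qb]]]; exists a, b; split=> //; lra. Qed.

Lemma fitsW Q p q p' q' : p <= p' -> q' <= q -> fits Q p q -> fits Q p' q'.
Proof. by move=> pp qq [a [b [Qab ap qb]]]; exists a, b; split=> //; lra. Qed.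

(** If two corresponding ends differed, one of them would lie strictly inside the other component
    and so belong to the open set. *)
Lemma component_uniq Q u v u' v' z : component Q u v -> component Q u' v' ->
  u < z -> z < v -> u' < z -> z < v' -> u = u' /\ v = v'.
Proof.
move=> [cu cv uv H] [cu' cv' uv' H'] uz zv uz' zv'; split.
  have [uu|uu|//] := ltgtP u u'; [have := H u' | have := H' u].
    by move=> K; exfalso; apply: cu'; apply: K => //; lra.
  by move=> K; exfalso; apply: cu; apply: K => //; lra.
have [uu|uu|//] := ltgtP v v'; [have := H' v | have := H v'].
  by move=> K; exfalso; apply: cv; apply: K => //; lra.
by move=> K; exfalso; apply: cv'; apply: K => //; lra.
Qed.

Lemma fits_inside_unit Q z : subunit Q -> fits_inside Q z z -> 0 < z /\ z < 1.
Proof. by move=> HQ [a [b [/HQ[a0 ab b1] az zb]]]; split; lra. Qed.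

Lemma component_unit Q u v : subunit Q -> component Q u v -> 0 <= u /\ v <= 1.
Proof.
move=> HQ [cu cv uv H]; split; rewrite leNgt; apply/negP => h.
  pose z := (u + Num.min v 0) / 2.
  have [] : u < z /\ z < v /\ z <= 0.
    by rewrite /z; case: (ltP v 0) => ?; do !split; lra.
  by move=> uz [zv z0]; have [] := fits_inside_unit HQ (H z uz zv); lra.
pose z := (v + Num.max u 1) / 2.
have [] : u < z /\ z < v /\ 1 <= z.
  by rewrite /z; case: (ltP u 1) => ?; do !split; lra.
by move=> uz [zv z0]; have [] := fits_inside_unit HQ (H z uz zv); lra.
Qed.

(** The ends are the nearest points outside of the open set on either side of [z]; [0] and [1] are
    such points, and by openness the supremum and infimum are again outside. *)
Lemma component_ex Q z : subunit Q -> fits_inside Q z z ->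
  exists u v, [/\ component Q u v, u < z & z < v].
Proof.
move=> HQ Hz; have [z0 z1] := fits_inside_unit HQ Hz.
pose A := [set x | x <= z /\ ~ fits_inside Q x x].
have A0 : A 0 by split; [lra|move=> /(fits_inside_unit HQ)[]; lra].
have hA : has_sup A by split; [exists 0|exists z => x []].
pose B := [set x | z <= x /\ ~ fits_inside Q x x].
have B1 : B 1 by split; [lra|move=> /(fits_inside_unit HQ)[]; lra].
have hB : has_inf B by split; [exists 1|exists z => x []].
have cu : ~ fits_inside Q (sup A) (sup A).
  move=> [a [b [Qab ap pb]]].
  have [x Ax xs] := @sup_adherent _ A (sup A - a) ltac:(lra) hA.
  have xA : x <= sup A by apply: ub_le_sup => //; case: hA.
  by case: (Ax) => _; apply; exists a, b; split=> //; lra.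
have cv : ~ fits_inside Q (inf B) (inf B).
  move=> [a [b [Qab ap pb]]].
  have [x Bx xs] := @inf_adherent _ B (b - inf B) ltac:(lra) hB.
  have xB : inf B <= x by apply: ge_inf => //; case: hB.
  by case: (Bx) => _; apply; exists a, b; split=> //; lra.
have uz : sup A <= z by apply: ge_sup; [exists 0|move=> x []].
have vz : z <= inf B by apply: lb_le_inf; [exists 1|move=> x []].
have uz' : sup A < z.
  by rewrite lt_neqAle uz andbT; apply/eqP => e; apply: cu; rewrite e.
have vz' : z < inf B.
  by rewrite lt_neqAle vz andbT; apply/eqP => e; apply: cv; rewrite -e.
exists (sup A), (inf B); split=> //; split=> //; first lra.
move=> x ux xv; apply: contrapT => cx; have [xz|zx] := leP x z.
  have := @ub_le_sup _ A; move=> /(_ hA.2 x (conj xz cx)); lra.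
have := @ge_inf _ B; move=> /(_ hB.2 x (conj (ltW zx) cx)); lra.
Qed.

(* Greedy choice: [w n.+1] lies just below the supremum of the [t] with
   [fits_inside Q (w n) t], and [w n.+2] above it. *)
Lemma chain_ex Q u v m : component Q u v -> u < m -> m < v ->
  exists w : nat -> R, [/\ w 0%N = m, forall n, w n <= v,
    forall n, w n < v -> w n < w n.+1, forall n, w n <= w n.+1 &
    [/\ forall n t, t <= w n.+1 -> t < v -> w n < v -> fits_inside Q (w n) t,
    forall n, w n.+2 < v -> ~ fits_inside Q (w n) (w n.+2) &
    forall s, s < v -> exists n, s < w n]].
Proof.
move=> [cu cv uv H] um mv.
(* A state is a chain point with a second point that it reaches. The second point of the next state
   is the supremum of the reach of the current chain point, and the chain point after that lies
   beyond it; this gives [wsep]. Once [v] is reached, the chain stays there. *)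
pose Inv (xp : R * R) := [/\ m <= xp.1, xp.1 <= v &
  xp.1 < v -> [/\ xp.1 <= xp.2, xp.2 < v & fits_inside Q xp.1 xp.2]].
pose Next (xp yz : R * R) := [/\ xp.1 = v -> yz.1 = v &
  xp.1 < v -> [/\ xp.1 < yz.1, xp.2 <= yz.1,
    forall t, t <= yz.1 -> t < v -> fits_inside Q xp.1 t &
    yz.1 < v -> ~ fits_inside Q xp.1 yz.2]].
have step (xp : R * R) : exists yz, Inv xp -> Inv yz /\ Next xp yz.
  have [[mx xv Ixp]|] := pselect (Inv xp); last by move=> nI; exists xp => /nI.
  case: xp mx xv Ixp => x p /= mx xv Ixp.
  have [xv'|vx] := ltP x v; last first.
    have xE : x = v by apply/eqP; rewrite eq_le xv vx.
    by exists (v, v) => _; rewrite /Inv /Next /=; do !split=> //; lra.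
  have [xp pv Fxp] := Ixp xv'.
  pose S := [set t | t < v /\ fits_inside Q x t].
  have Sp : S p by [].
  have hS : has_sup S by split; [exists p|exists v => t [/ltW]].
  (* Members are taken open here, so [S] has no maximum and contains everything below its
     supremum. *)
  have Sle t : S t -> t < sup S.
    move=> [tv [a [b [Qab ax tb]]]].
    have hm : t < Num.min b v by rewrite lt_min tb tv.
    have : (t + Num.min b v) / 2 <= sup S.
      apply: ub_le_sup; first by case: hS.
      have : Num.min b v <= b by rewrite ge_min lexx.
      have : Num.min b v <= v by rewrite ge_min lexx orbT.
      move: (Num.min b v) hm => w *; split; first lra.
      by exists a, b; split=> //; lra.
    lra.
  have Slt t : t < sup S -> S t.
    move=> tS; have tS' : 0 < sup S - t by lra.
    have [t' [tv' Ft'] tt'] := sup_adherent tS' hS.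
    have {}tt' : t < t' by lra.
    by split; [lra | apply: fits_insideW Ft'; lra].
  have Sv : sup S <= v by apply: ge_sup; [exists p | move=> t [/ltW]].
  have [Sv'|vS] := ltP (sup S) v; last first.
    exists (v, v) => _; rewrite /Inv /Next /=; do !split=> //; try lra.
    by move=> t _ tv; have [] : S t by apply: Slt; lra.
  have pz := Sle _ Sp.
  have [a [b [Qab az zb]]] : fits_inside Q (sup S) (sup S) by apply: H; lra.
  (* To the right of [a], so that the member around [sup S] takes [y] beyond [sup S]; to the right
     of [p], so that the chain passes the previous reach. *)
  pose y := (Num.max p a + sup S) / 2.
  have [py ay yz] : [/\ p < y, a < y & y < sup S].
    have : Num.max p a < sup S by rewrite gt_max pz az.
    have : p <= Num.max p a by rewrite le_max lexx.
    have : a <= Num.max p a by rewrite le_max lexx orbT.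
    by rewrite /y; move: (Num.max p a) => *; split; lra.
  exists (y, sup S) => _; rewrite /Inv /Next /=; do !split=> //; try lra.
  - by exists a, b; split.
  - by move=> t ty tv; have [] : S t by apply: Slt; lra.
  - by move=> _ Fz; have := Sle _ (conj Sv' Fz); lra.
have [f fP] := choice step.
pose st n := iter n f (m, m).
have stI n : Inv (st n).
  elim: n => [|n IH] /=; last by have [] := fP _ IH.
  by split=> /=; [lra|lra|move=> _; split=> //; apply: H].
have stN n : Next (st n) (st n.+1) by have [] := fP _ (stI n).
have wv n : (st n).1 <= v by have [] := stI n.
have wlt n : (st n).1 < v -> (st n).1 < (st n.+1).1.
  by move=> h; have [_ /(_ h)[]] := stN n.
have wle n : (st n).1 <= (st n.+1).1.
  have [/wlt/ltW//|vw] := ltP (st n).1 v.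
  have e : (st n).1 = v by apply/eqP; rewrite eq_le wv vw.
  by have [/(_ e) -> _] := stN n; rewrite e.
have wsep n : (st n.+2).1 < v -> ~ fits_inside Q (st n).1 (st n.+2).1.
  move=> h; have h1 : (st n.+1).1 < v by apply: le_lt_trans h.
  have h0 : (st n).1 < v by apply: le_lt_trans h1.
  have [_ /(_ h0)[_ _ _ /(_ h1) nF]] := stN n.
  have [_ /(_ h1)[_ le2 _ _]] := stN n.+1.
  by move=> F; apply: nF; apply: fits_insideW F.
exists (fun n => (st n).1); split=> //; split=> // [n t tw tv nv|s sv].
  by have [_ /(_ nv)[_ _ + _]] := stN n; apply.
(* If the chain stayed below [s < v], a member around its supremum would contain [w n] and [w n.+2]
   for some [n], against [wsep]. *)
apply: contrapT => /forallNP ws.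
have {}ws n : (st n).1 <= s by rewrite leNgt; apply/negP.
pose W := range (fun n => (st n).1).
have hW : has_sup W by split; [exists (st 0%N).1, 0%N|exists s => _ [n _ <-]].
have Ws : sup W <= s by apply: ge_sup; [case: hW|move=> _ [n _ <-]].
have Wn n : (st n).1 <= sup W by apply: ub_le_sup; [case: hW|exists n].
have [a [b [Qab az zb]]] : fits_inside Q (sup W) (sup W).
  by apply: H; have := Wn 0%N; rewrite /=; lra.
have aW : 0 < sup W - a by lra.
have [_ [n _ <-] wn] := sup_adherent aW hW.
apply: (wsep n); first by have := ws n.+2; lra.
by exists a, b; split=> //; [lra|have := Wn n.+2; lra].
Qed.

End Components.

(** * Test quadruples *)

Section Quads.
Variable R : realType.
Implicit Types (Q : R -> R -> Prop) (f : R -> R) (a b p q s t u v x y z : R).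

(* A quadruple ((x, x'), (y, y')) stands for a rank one operator that maps the
   part of the space over the interval (y, y') to the part over (x, x'). *)
Definition quad := ((R * R) * (R * R))%type.
Implicit Types (c : quad) (T : set quad).

(** The left interval ends before the right one begins, which puts the rank one operator into the
    nest algebra. *)
Definition quad_valid c :=
  [/\ 0 <= c.1.1, c.1.1 < c.1.2, c.1.2 <= c.2.1, c.2.1 < c.2.2 & c.2.2 <= 1].

(** Outside of this set, compression to [(a, b)] kills the operator: the left interval lies below
    [a] or the right one above [b]. *)
Definition touching a b : set quad := [set c | a < c.1.2 /\ c.2.1 < b].

Definition inside s t : set quad := [set c | s <= c.1.1 /\ c.2.2 <= t].

Lemma infinite_seq (X : Type) (A : set X) (h : nat -> X) :
  injective h -> (forall n, A (h n)) -> infinite_set A.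
Proof.
move=> hI hA fA; apply: infinite_nat.
have -> : [set: nat] = h @^-1` A by apply/seteqP; split=> n _ //; apply: hA.
by apply: finite_preimage => // x y _ _; apply: hI.
Qed.

Lemma infinite_subset (X : Type) (A B : set X) :
  A `<=` B -> infinite_set A -> infinite_set B.
Proof. by move=> AB iA /(sub_finite_set AB). Qed.

Lemma countable_seq (X : Type) (h : nat -> X) : countable (range h).
Proof. exact: sub_countable (card_image_le _ _) (countableP _). Qed.

Lemma unit_iso_ltW f x y : unit_iso f -> 0 <= y -> x <= 1 -> f x < f y -> x < y.
Proof.
move=> [_ _ H _] y0 x1 fxy; have [//|yx] := ltP x y.
move: yx; rewrite le_eqVlt => /predU1P[yE|yx]; first by move: fxy; rewrite yE ltxx.
by have := H _ _ y0 x1 yx; lra.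
Qed.

Lemma unit_iso_leW f x y : unit_iso f -> 0 <= y -> x <= 1 -> f x <= f y -> x <= y.
Proof.
move=> [_ _ H _] y0 x1 fxy; rewrite leNgt; apply/negP => yx.
by have := H _ _ y0 x1 yx; lra.
Qed.

(** The interior of a member belongs to the open set, so it cannot contain an end of a component. *)
Lemma component_fits Q u v a b z : component Q u v -> fits Q a b ->
  a < z -> z < b -> u < z -> z < v -> u <= a /\ b <= v.
Proof.
move=> [cu cv _ _] [a0 [b0 [Qab aa bb]]] az zb uz zv.
split; rewrite leNgt; apply/negP => h.
  by apply: cu; exists a0, b0; split=> //; lra.
by apply: cv; exists a0, b0; split=> //; lra.
Qed.

Lemma touching_point a b c : quad_valid c -> a < b -> touching a b c ->
  exists z, [/\ a < z, z < b, c.1.1 < z & z < c.2.2].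
Proof.
move=> [x0 xx xy yy y1] ab [ax yb]; exists ((Num.max a c.1.1 + c.1.2) / 2).
have : Num.max a c.1.1 < c.1.2 by rewrite gt_max ax xx.
have : a <= Num.max a c.1.1 by rewrite le_max lexx.
have : c.1.1 <= Num.max a c.1.1 by rewrite le_max lexx orbT.
by move: (Num.max _ _) => w *; split; lra.
Qed.

Lemma harmonic_small d : 0 < d -> forall h : R, exists k : nat, h / (k.+1%:R) < d.
Proof.
move=> d0 h; have [h0|h0] := leP h 0.
  by exists 0%N; rewrite divr1; lra.
exists (Num.truncn (h / d)); rewrite ltr_pdivrMr ?ltr0n // mulrC.
by rewrite -ltr_pdivrMr // truncnS_gt.
Qed.

(* If no member of [Q] contains an interval [(u, t)], the quadruples shrink to
   [u].  Otherwise they approach the ends of [(u, w)], where [w] is the supremum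
   of the [t] for which one does. *)
Lemma left_end_quads Q f u v : subunit Q -> component Q u v -> unit_iso f ->
  f u = u -> (forall z, u < z -> z < v -> f z < z) ->
  exists T, [/\ countable T,
    forall c, T c -> [/\ quad_valid c, u <= c.1.1 & c.2.2 <= v],
    forall a b, a < b -> fits Q a b -> fits (image_intervals f Q) a b ->
      finite_set (T `&` touching a b) &
    forall t, u < t -> t <= v -> ~ fits Q u t -> infinite_set (T `&` inside u t)].
Proof.
move=> HQ cuv fiso fu flt; have [u0 v1] := component_unit HQ cuv.
have uv : u < v by case: cuv.
pose S := [set t | [/\ u < t, t <= v & fits Q u t]].
have sub_u T a b c : (forall c, T c -> [/\ quad_valid c, u <= c.1.1 & c.2.2 <= v]) ->
    a < b -> fits Q a b -> T c -> touching a b c -> u <= a /\ b <= v.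
  move=> HT ab Fab Tc tc; have [vc uc cv] := HT _ Tc.
  have [z [az zb xz zy]] := touching_point vc ab tc.
  by apply: (component_fits cuv Fab az zb); lra.
have [[t0 St0]|nS] := pselect (S !=set0); last first.
  pose h (k : nat) : R := (v - u) / k.+1%:R.
  have h0 k : 0 < h k by rewrite divr_gt0 ?ltr0n //; lra.
  have hanti k l : (k < l)%N -> h l < h k.
    by move=> kl; rewrite ltr_pM2l ?subr_gt0 // ltf_pV2 ?posrE ?ltr0n // ltr_nat.
  have h1 k : h k <= v - u.
    by rewrite ler_pdivrMr ?ltr0n // ler_peMr ?ler1n //; lra.
  pose g k : quad := ((u, u + h k / 2), (u + h k / 2, u + h k)).
  have gI : injective g.
    move=> k l [_ _ E]; have {}E : h k = h l by lra.
    by have [/hanti|/hanti|//] := ltngtP k l => hkl; exfalso; lra.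
  have Hg c : range g c -> [/\ quad_valid c, u <= c.1.1 & c.2.2 <= v].
    move=> [k _ <-]; have := h0 k; have := h1 k.
    by split; [split=> /=| |] => /=; lra.
  exists (range g); split=> //; first exact: countable_seq.
    move=> a b ab Fab _.
    (* If [a <= u], a touched quadruple would put [b] into [S]. If [u < a], all but finitely many
       quadruples lie to the left of [a]. *)
    have [ua|au] := ltP u a; last first.
      suff -> : range g `&` touching a b = set0 by exact: finite_set0.
      apply/seteqP; split=> // c [Tc tc].
      have [ua bv] := sub_u _ _ _ _ Hg ab Fab Tc tc.
      apply: nS; exists b; split=> //; first lra.
      by apply: fitsW Fab.
    have da : 0 < a - u by lra.
    have [N hN] := harmonic_small da (v - u).
    apply: (@sub_finite_set _ _ (g @` `I_N)); last exact/finite_image/finite_II.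
    move=> _ [[k _ <-] [/= t1 t2]]; exists k => //=.
    rewrite ltnNge; apply/negP => Nk.
    have : h k <= h N.
      by move: Nk; rewrite leq_eqVlt => /predU1P[->//|/hanti/ltW].
    rewrite -/(h N) in hN; have := h0 k; lra.
  move=> t ut tv _; have dt : 0 < t - u by lra.
  have [N hN] := harmonic_small dt (v - u).
  apply: (@infinite_seq _ _ (fun k => g (k + N)%N)).
    by move=> k l /gI/eqP; rewrite eqn_add2r => /eqP.
  move=> k; split; first by exists (k + N)%N.
  split=> //=; have : h (k + N)%N <= h N.
    by case: k => [|k] //; apply: ltW; apply: hanti; rewrite addSn ltnS leq_addl.
  by rewrite -/(h N) in hN; lra.
have hS : has_sup S by split; [exists t0|exists v => t []].
pose w := sup S.
have wv : w <= v by apply: ge_sup; [exists t0|move=> t []].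
have uw : u < w.
  by case: (St0) => h _ _; apply: lt_le_trans h _; apply: ub_le_sup; case: hS.
(* In this case no bad interval starts at [u], and no quadruples are needed. *)
have [Guv|Guv] := pselect (fits Q u v).
  exists set0; split=> //; first by move=> a b _ _ _; rewrite set0I; exact: finite_set0.
  by move=> t ut tv []; apply: fitsW Guv.
(* The denominators start at 2 so that the intervals at the two ends of [(u, w)] do not overlap. *)
pose h (k : nat) : R := (w - u) / k.+2%:R.
have h0 k : 0 < h k by rewrite divr_gt0 ?ltr0n //; lra.
have hanti k l : (k < l)%N -> h l < h k.
  by move=> kl; rewrite ltr_pM2l ?subr_gt0 // ltf_pV2 ?posrE ?ltr0n // ltr_nat.
have h1 k : h k <= (w - u) / 2.
  by rewrite ler_pM2l ?subr_gt0 // lef_pV2 ?posrE ?ltr0n // ler_nat.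
have hlt1 k : h k < (w - u) / k.+1%:R.
  by rewrite ltr_pM2l ?subr_gt0 // ltf_pV2 ?posrE ?ltr0n // ltr_nat.
pose g k : quad := ((u, u + h k), (w - h k, w)).
have gI : injective g.
  move=> k l [E _]; have {}E : h k = h l by lra.
  by have [/hanti|/hanti|//] := ltngtP k l => hkl; exfalso; lra.
have Hg c : range g c -> [/\ quad_valid c, u <= c.1.1 & c.2.2 <= v].
  move=> [k _ <-]; have := h0 k; have := h1 k.
  by split; [split=> /=| |] => /=; lra.
(* No interval that fits both [Q] and its image contains [(u, w)]. For [w = v] the whole component
   would fit. For [w < v] the map [f] moves [w] to the left, so the member whose image covers
   [(u, w)] itself extends beyond [w], against the choice of [w]. *)
have wbad a b : fits Q a b -> fits (image_intervals f Q) a b -> ~ (a <= u /\ w <= b).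
  move=> Fab Fab' [au wb]; have [wv'|vw] := ltP w v; last first.
    by apply: Guv; apply: fitsW Fab; lra.
  case: Fab' => _ [_ [[a0 [b0 [Qab -> ->]]] aa bb]].
  have [a00 ab0 b01] := HQ _ _ Qab.
  have au0 : a0 <= u.
    by apply: (unit_iso_leW fiso); rewrite ?fu; lra.
  have wb0 : w < b0.
    have fw := flt _ uw wv'.
    by apply: (unit_iso_ltW fiso); lra.
  have b0v : b0 <= v.
    rewrite leNgt; apply/negP => vb; case: cuv => _ cv _ _; apply: cv.
    by exists a0, b0; split=> //; lra.
  have : S b0 by split=> //; [lra|exists a0, b0; split].
  by move=> /(ub_le_sup hS.2); rewrite -/w; lra.
exists (range g); split=> //; first exact: countable_seq.
  move=> a b ab Fab Fab'.
  (* An interval that touches all quadruples would contain [(u, w)]. Once one quadruple is missed,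
     so are the later ones, which are closer to the ends. *)
  have [N HN] : exists N, ~ touching a b (g N).
    apply: contrapT => /forallNP ht.
    have {}ht k : a < u + h k /\ w - h k < b by exact: contrapT (ht k).
    apply: (wbad _ _ Fab Fab'); split; rewrite leNgt; apply/negP => hlt.
      have da : 0 < a - u by lra.
      have [N hN] := harmonic_small da (w - u).
      have [hN' _] := ht N.
      have hN2 := hlt1 N; move: hN hN' hN2; move: (h N) (_ / _) => *; lra.
    have da : 0 < w - b by lra.
    have [N hN] := harmonic_small da (w - u).
    have [_ hN'] := ht N.
    have hN2 := hlt1 N; move: hN hN' hN2; move: (h N) (_ / _) => *; lra.
  apply: (@sub_finite_set _ _ (g @` `I_N)); last exact/finite_image/finite_II.
  move=> _ [[k _ <-] [/= t1 t2]]; exists k => //=.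
  rewrite ltnNge; apply/negP => Nk; apply: HN.
  have : h k <= h N.
    by move: Nk; rewrite leq_eqVlt => /predU1P[->//|/hanti/ltW].
  by split=> /=; lra.
(* Intervals from [u] to a point below [w] fit, so a bad one contains all of the quadruples. *)
move=> t ut tv nF; have wt : w <= t.
  rewrite leNgt; apply/negP => tw.
  have dt : 0 < w - t by lra.
  have [t1 [_ _ F1] tt1] := sup_adherent dt hS.
  by apply: nF; apply: fitsW F1 => //; rewrite -/w in tt1; lra.
apply: (infinite_seq gI) => k; split; first by exists k.
by split.
Qed.
End Quads.

(** * Test systems for a family of intervals *)

Section Tests.
Variable R : realType.
Implicit Types (Q : R -> R -> Prop) (f : R -> R) (a b p q s t u v x y z : R).
Implicit Types (c : quad R) (T : set (quad R)) (L : nat -> R -> R) (n : nat).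

(** Rationality makes the set countable. An interval that touches such a quadruple contains its gap
    [[c.1.2, c.2.1]], so it cannot fit into all images of [Q]. *)
Definition rational_quads Q n L : set (quad R) := [set c | [/\ quad_valid c,
  exists r : (rat * rat) * (rat * rat),
    c = ((ratr r.1.1, ratr r.1.2), (ratr r.2.1, ratr r.2.2)) &
  exists2 i, (i < n)%N & ~ fits_inside (image_intervals (L i) Q) c.1.2 c.2.1]].

Lemma countable_rational_quads Q n L : countable (rational_quads Q n L).
Proof.
pose h (r : (rat * rat) * (rat * rat)) : quad R :=
  ((ratr r.1.1, ratr r.1.2), (ratr r.2.1, ratr r.2.2)).
apply: (@sub_countable _ _ _ (range h)).
  by apply: subset_card_le => c [_ [r ->] _]; exists r.
exact: sub_countable (card_image_le _ _) (countableP _).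
Qed.

Lemma rational_quads_touching Q n L a b :
  (forall i, (i < n)%N -> fits (image_intervals (L i) Q) a b) ->
  rational_quads Q n L `&` touching a b = set0.
Proof.
move=> F; apply/seteqP; split=> // c [[vc _ [i /F[a0 [b0 [Qab aa bb]]] nF]] [ac cb]].
by apply: nF; exists a0, b0; split=> //; lra.
Qed.

(** The room on both sides of [[p, q]] takes rational intervals, so that the gap contains [[p, q]];
    the leftmost end varies in disjoint windows approaching [s], which gives infinitely many
    quadruples. *)
Lemma rational_quads_inside Q n L i s t p q : 0 <= s -> t <= 1 -> (i < n)%N ->
  s < p -> p <= q -> q < t -> ~ fits_inside (image_intervals (L i) Q) p q ->
  infinite_set (rational_quads Q n L `&` inside s t).
Proof.
move=> s0 t1 ni sp pq qt nF.
have [rx] := rat_in_itvoo sp; rewrite in_itv /= => /andP[srx rxp].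
have [ry] := rat_in_itvoo qt; rewrite in_itv /= => /andP[qry ryt].
have [rz] := rat_in_itvoo ryt; rewrite in_itv /= => /andP[ryrz rzt].
pose d : R := ratr rx - s; have d0 : 0 < d by rewrite /d; lra.
have H k : exists r : rat, s + d / k.+2%:R < ratr r /\ ratr r < s + d / k.+1%:R.
  have h : s + d / k.+2%:R < s + d / k.+1%:R.
    by rewrite ltrD2l ltr_pM2l // ltf_pV2 ?posrE ?ltr0n // ltr_nat.
  by have [r] := rat_in_itvoo h; rewrite in_itv /= => /andP[]; exists r.
have [g gP] := choice H.
have ganti k l : (k < l)%N -> ratr (g l) < ratr (g k) :> R.
  move=> kl; have [_ gl] := gP l; have [gk _] := gP k.
  have : d / l.+1%:R <= d / k.+2%:R.
    by rewrite ler_pM2l // lef_pV2 ?posrE ?ltr0n // ler_nat.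
  move: gl gk; move: (_ / _) (d / _) => *; lra.
have gs k : s < ratr (g k).
  have [gk _] := gP k; have : 0 < d / k.+2%:R by rewrite divr_gt0 ?ltr0n.
  move: gk; move: (_ / _) => *; lra.
have gx k : ratr (g k) < ratr rx :> R.
  have [_ gk] := gP k; have -> : ratr rx = s + d by rewrite /d; lra.
  apply: lt_le_trans gk _; rewrite lerD2l.
  by rewrite ler_pdivrMr ?ltr0n // ler_peMr ?ler1n // ltW.
pose h k : quad R := ((ratr (g k), ratr rx), (ratr ry, ratr rz)).
apply: (@infinite_seq _ _ h).
  move=> k l [E]; have [/ganti|/ganti|//] := ltngtP k l.
    by move=> hkl; exfalso; lra.
  by move=> hkl; exfalso; lra.
move=> k; have := gs k; have := gx k; split; last by split=> /=; lra.
split; first by split=> /=; lra.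
  by exists ((g k, rx), (ry, rz)).
by exists i => //= F; apply: nF; apply: fits_insideW F; lra.
Qed.

Lemma fits_image_id Q a b : fits (image_intervals id Q) a b -> fits Q a b.
Proof. by move=> [_ [_ [[a0 [b0 [Qab -> ->]]] aa bb]]]; exists a0, b0. Qed.

Lemma fits_inside_image Q f s t : subunit Q -> unit_iso f -> 0 <= s -> s <= 1 ->
  0 <= t -> t <= 1 -> fits_inside (image_intervals f Q) (f s) (f t) ->
  fits_inside Q s t.
Proof.
move=> HQ fi s0 s1 t0 t1 [_ [_ [[a [b [Qab -> ->]]] aa bb]]].
have [a0 ab b1] := HQ _ _ Qab.
by exists a, b; split=> //; apply: (unit_iso_ltW fi) => //; lra.
Qed.

(* The data from which the separating operator is built: it must vanish, up to
   finite rank, on the intervals that refine [Q] and its finitely many images. *)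
Definition test_system Q n L T := [/\ forall i, (i < n)%N -> unit_iso (L i),
  countable T, T `<=` @quad_valid R &
  forall a b, a < b -> (forall i, (i < n)%N -> fits (image_intervals (L i) Q) a b) ->
    finite_set (T `&` touching a b)].

(* Each bad interval has one of the given positions, possibly after the
   reflection [x |-> 1 - x]. *)
Lemma half_test_system Q : subunit Q -> exists n L T, test_system Q n L T /\
  forall s t, 0 <= s -> t <= 1 -> s < t -> ~ fits Q s t ->
    (exists z, [/\ s < z, z < t & ~ fits_inside Q z z]) \/
    (exists u v, component Q u v /\ [\/ s = u /\ t <= v,
       [/\ u < s, s < (u + v) / 2, (u + v) / 2 < t & t < v] |
       [/\ u < s, (u + v) / 2 <= s & t < v]]) ->
    infinite_set (T `&` inside s t).
Proof.
move=> HQ; pose U : set R := [set z | fits_inside Q z z].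
have U01 z : U z -> 0 < z /\ z < 1 by exact: fits_inside_unit.
have nU0 : ~ U 0 by move=> /U01[]; lra.
have nU1 : ~ U 1 by move=> /U01[]; lra.
(* [e z] is the component of [z], with a default value off [U]. *)
have /choice[e eP] : forall z, exists uv : (R * R)%type, U z ->
    [/\ component Q uv.1 uv.2, uv.1 < z & z < uv.2].
  move=> z; have [/(component_ex HQ)[u [v H]]|nU] := pselect (U z).
    by exists (u, v).
  by exists (0, 0).
have eE u v z : component Q u v -> u < z -> z < v -> U z /\ e z = (u, v).
  move=> cuv uz zv; have Uz : U z by case: cuv => _ _ _; apply.
  split=> //; have [ce ez1 ez2] := eP _ Uz.
  have [<- <-] := component_uniq ce cuv ez1 ez2 uz zv.
  by case: (e z).
(* [W uv] is a chain from the midpoint of the component towards its right end. *)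
have /choice[W WP] : forall uv : (R * R)%type, exists w : nat -> R,
  component Q uv.1 uv.2 -> [/\ w 0%N = (uv.1 + uv.2) / 2, forall n, w n <= uv.2,
    forall n, w n < uv.2 -> w n < w n.+1, forall n, w n <= w n.+1 &
    [/\ forall n t, t <= w n.+1 -> t < uv.2 -> w n < uv.2 ->
          fits_inside Q (w n) t,
    forall n, w n.+2 < uv.2 -> ~ fits_inside Q (w n) (w n.+2) &
    forall s, s < uv.2 -> exists n, s < w n]].
  move=> uv; have [cuv|nc] := pselect (component Q uv.1 uv.2); last first.
    by exists (fun=> 0).
  have uv' : uv.1 < uv.2 by case: cuv.
  by have [||w wP] := @chain_ex _ Q _ _ ((uv.1 + uv.2) / 2) cuv;
    [lra|lra|exists w].
(* The chain with the left end of the component put in front, so indices shift by one. *)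
pose W' (uv : R * R) n := if n is k.+1 then W uv k else uv.1.
have W'le uv k l : component Q uv.1 uv.2 -> (k <= l)%N -> W' uv k <= W' uv l.
  move=> cuv; have [W0 _ _ Wle _] := WP _ cuv.
  have uv' : uv.1 < uv.2 by case: cuv.
  apply: (homo_leq (@lexx _ _) (@le_trans _ _)).
  by case=> [|m] //=; rewrite W0; lra.
(* Modulo 5 the pieces of [Pc i] and [Nc i] alternate without overlapping. *)
pose Pc i : set R := [set x | U x /\ exists n, [/\ (n %% 5)%N = i,
  W' (e x) n < x & x < W' (e x) n.+2]].
pose Nc i : set R := [set x | U x /\ exists n, [/\ (n %% 5)%N = i,
  W' (e x) n.+2 < x & x < W' (e x) n.+4.+1]].
have PNc i : Pc i `&` Nc i `<=` set0.
  move=> x [[Ux [k [ki k1 k2]]] [_ [l [li l1 l2]]]].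
  have [ce _ _] := eP _ Ux.
  have [kl|lk] := leqP k l.
    by have := W'le _ _ _ ce (_ : (k.+2 <= l.+2)%N); rewrite !ltnS => /(_ kl); lra.
  have : (l.+4.+1 <= k)%N by lia.
  by move=> /(W'le _ _ _ ce); lra.
pose mid x := ((e x).1 + (e x).2) / 2.
pose Pm : set R := [set x | U x /\ x < mid x].
pose Nm : set R := [set x | U x /\ mid x < x].
have PNm : Pm `&` Nm `<=` set0 by move=> x [[_ h1] [_ h2]]; lra.
(* Eight maps: the identity, a shift of [U] to the left, a motion towards the midpoint of each
   component, and for each residue modulo 5 a motion towards every fifth point of the chains. *)
pose L i : R -> R := if i is i'.+1 then if i' is i''.+1 then
  if i'' is j.+1 then push (Pc j) (Nc j) else push Pm Nm
  else push set0 U else id.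
have Lsub A : A `<=` U -> ~ A 0 /\ ~ A 1.
  by move=> AU; split=> /AU.
have PcU i : Pc i `<=` U by move=> x [].
have NcU i : Nc i `<=` U by move=> x [].
have PmU : Pm `<=` U by move=> x [].
have NmU : Nm `<=` U by move=> x [].
have piso A B : A `<=` U -> B `<=` U -> unit_iso (push A B).
  by move=> AU BU; have [A0 A1] := Lsub _ AU; have [B0 B1] := Lsub _ BU; exact: push_iso.
have Liso i : unit_iso (L i).
  case: i => [|[|[|j]]] /=; try exact: piso.
  by split=> // y y0 y1; exists y.
pose f := push set0 U.
have fU z : U z -> f z < z.
  move=> Uz; have [ce h1 h2] := eP _ Uz.
  apply: (push_lt _ _ _ h1 h2) => // y y1 y2.
  by have [] := eE _ _ y ce y1 y2.
have fnU z : ~ U z -> f z = z by move=> nUz; apply: push_fix.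
have /choice[S SP] : forall uv : (R * R)%type, exists S : set (quad R),
  component Q uv.1 uv.2 -> [/\ countable S,
    forall c, S c -> [/\ quad_valid c, uv.1 <= c.1.1 & c.2.2 <= uv.2],
    forall a b, a < b -> fits Q a b -> fits (image_intervals f Q) a b ->
      finite_set (S `&` touching a b) &
    forall t, uv.1 < t -> t <= uv.2 -> ~ fits Q uv.1 t ->
      infinite_set (S `&` inside uv.1 t)].
  move=> uv; have [cuv|nc] := pselect (component Q uv.1 uv.2); last first.
    by exists set0.
  have [||S SP] := left_end_quads HQ cuv (Liso 1%N).
  - by apply: fnU; case: cuv.
  - by move=> z h1 h2; apply: fU; case: cuv => _ _ _; apply.
  by exists S.
(* Each component contains a rational, so countably many of the sets [S] suffice. *)
pose Sp : set (quad R) := \bigcup_(r in [set r : rat | U (ratr r)]) S (e (ratr r)).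
pose T := rational_quads Q 8 L `|` Sp.
exists 8%N, L, T; split; first split.
- by move=> i _; exact: Liso.
- rewrite /T; have -> : rational_quads Q 8 L `|` Sp =
    \bigcup_(b in [set: bool]) (if b then rational_quads Q 8 L else Sp).
    apply/seteqP; split=> [c [h|h]|c [[] _ h]];
      [by exists true|by exists false|by left|by right].
  apply: bigcup_countable => [|[] _]; first exact: countableP.
    exact: countable_rational_quads.
  apply: bigcup_countable => [|r Ur]; first exact: countableP.
  by have [ce _ _] := eP _ Ur; have [] := SP _ ce.
- move=> c [[]//|[r /= Ur Sc]]; have [ce _ _] := eP _ Ur.
  by have [_ /(_ _ Sc)[]] := SP _ ce.
- move=> a b ab F; rewrite /T setIUl finite_setU; split.
    by rewrite rational_quads_touching //; exact: finite_set0.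
  have F0 : fits Q a b by apply: fits_image_id; exact: (F 0%N).
  have F1 := F 1%N isT.
  (* An interval that fits [Q] and touches a quadruple of [Sp] lies in the same component, and so
     does its midpoint. Hence only one set [S] contributes. *)
  have H c : Sp c -> touching a b c -> U ((a + b) / 2) /\ S (e ((a + b) / 2)) c.
    move=> [r /= Ur Sc] tc; have [ce _ _] := eP _ Ur.
    have [_ /(_ _ Sc)[vc uc cv] _ _] := SP _ ce.
    have [z [az zb xz zy]] := touching_point vc ab tc.
    have [ua bv] := component_fits ce F0 az zb ltac:(lra) ltac:(lra).
    have [||Um em] := eE _ _ ((a + b) / 2) ce; [lra|lra|].
    by rewrite em -surjective_pairing.
  have [Um|nU] := pselect (U ((a + b) / 2)); last first.
    suff -> : Sp `&` touching a b = set0 by exact: finite_set0.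
    by apply/seteqP; split=> // c [Sc tc]; have [] := H c Sc tc.
  have [ce _ _] := eP _ Um; have [_ _ + _] := SP _ ce.
  move=> /(_ _ _ ab F0 F1); apply: sub_finite_set => c [Sc tc].
  by have [_ ?] := H c Sc tc; split.
move=> s t s0 t1 st nF H.
have contr i p q : (i < 8)%N -> s < p -> p <= q -> q < t ->
    ~ fits_inside (image_intervals (L i) Q) p q -> infinite_set (T `&` inside s t).
  move=> i8 sp pq qt nFi.
  apply: infinite_subset (rational_quads_inside s0 t1 i8 sp pq qt nFi).
  by move=> c [? ?]; split=> //; left.
(* [L i] moves [[s, t']] strictly into itself. The image does not fit inside an image of a member,
   since this would pull back to [[s, t']]; the margins leave room for rational quadruples. *)
have contr2 i t' : (i < 8)%N -> s < t' -> t' <= t -> ~ fits_inside Q s t' ->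
    s < L i s -> L i t' < t' -> infinite_set (T `&` inside s t).
  move=> i8 st' tt nFs s1 t2; have [_ _ /(_ s t') Lmon _] := Liso i.
  have t'1 := le_trans tt t1; have s1' := le_trans (ltW st') t'1.
  apply: (contr i (L i s) (L i t')) => //.
  - by apply: ltW; exact: Lmon.
  - exact: lt_le_trans t2 tt.
  - move=> /(fits_inside_image HQ (Liso i)) h; apply: nFs; apply: h => //.
    exact: le_trans s0 (ltW st').
have nFI : ~ fits_inside Q s t by move=> /fits_inside_fits.
case: H => [[z [sz zt nFz]]|[u [v [cuv H]]]].
  apply: (contr 0%N z z) => // -[_ [_ [[a [b [Qab -> ->]]] az zb]]].
  by apply: nFz; exists a, b.
case: H => [[su tv]|[us sm mt tv]|[us ms tv]].
- have uv : u < v by case: cuv.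
  have [r] := rat_in_itvoo uv; rewrite in_itv /= => /andP[ur rv].
  have [Ur er] := eE _ _ _ cuv ur rv.
  have := SP (u, v) cuv; rewrite /= -er => -[_ _ _ /(_ t)]; rewrite er /= -su.
  move=> /(_ st tv nF); apply: infinite_subset => c [Sc ic]; split=> //.
  by right; exists r => //; rewrite er -su.
- apply: (contr2 2%N t) => //=.
    apply: (@push_gt _ _ _ _ u ((u + v) / 2)) => //.
    + by move=> /PmU.
    + by move=> /NmU.
    + move=> y uy ym; have yv := lt_trans ym (lt_trans mt tv).
      by have [Uy ey] := eE _ _ y cuv uy yv; split=> //; rewrite /mid ey.
  apply: (@push_lt _ _ _ _ ((u + v) / 2) v) => //.
  + by move=> /PmU.
  + by move=> /NmU.
  + move=> y my yv; have uy := lt_trans (lt_trans us sm) my.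
    by have [Uy ey] := eE _ _ y cuv uy yv; split=> //; rewrite /mid ey.
have [W0 Wv Wlt Wle [Win Wout Wex]] := WP (u, v) cuv.
rewrite /= in W0 Wv Wlt Win Wout Wex.
have sv : s < v by lra.
(* [W k] is the last chain point that does not exceed [s]. *)
have [k [kP kmin]] : exists k, s < W (u, v) k.+1 /\ W (u, v) k <= s.
  have ex := Wex _ sv; case: (ex_minnP ex) => -[|k] sk kmin.
    by move: sk; rewrite W0; lra.
  exists k; split=> //; rewrite leNgt; apply/negP => /kmin.
  by rewrite ltnn.
(* Otherwise [W k], and hence [s], would reach [t] within one member. *)
have tk : W (u, v) k.+1 < t.
  rewrite ltNge; apply/negP => tk; apply: nFI.
  by apply: (fits_insideW kmin (lexx t)); apply: Win => //; exact: le_lt_trans kmin sv.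
(* Cutting at [W k.+3] keeps [t'] in the piece that moves to the left, and [[s, t']] still fits
   inside no member because [[W k.+1, W k.+3]] does not. *)
pose t' := Num.min t (W (u, v) k.+3).
have t't : t' <= t by rewrite ge_min lexx.
have t'k : t' <= W (u, v) k.+3 by rewrite ge_min lexx orbT.
have kt' : W (u, v) k.+1 < t'.
  rewrite lt_min tk /=; apply: lt_le_trans (Wle _); apply: Wlt; exact: lt_trans tk tv.
have nFt' : ~ fits_inside Q s t'.
  have [tk3|k3t] := leP t (W (u, v) k.+3); first by rewrite /t' min_l.
  rewrite /t' min_r ?(ltW k3t) // => F; apply: (Wout k.+1).
    exact: lt_trans k3t tv.
  by apply: fits_insideW F => //; exact: ltW.
have kk3 : t' < W (u, v) k.+4.
  have [k3v|vk3] := ltP (W (u, v) k.+3) v; first exact: le_lt_trans t'k (Wlt _ k3v).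
  exact: lt_le_trans (le_lt_trans t't tv) (le_trans vk3 (Wle _)).
have i8 : ((k %% 5).+3 < 8)%N by exact: (ltn_pmod k (isT : (0 < 5)%N)).
(* For [k = 0] the piece begins at [u], as the chain itself starts only at the midpoint. *)
have ks : W' (u, v) k < s.
  case: k kP kmin {tk t' t't t'k kt' nFt' kk3 i8} => [|k] kP kmin //=.
  by apply: (lt_le_trans _ kmin); apply: Wlt; exact: le_lt_trans (Wle k) (le_lt_trans kmin sv).
have uk : u <= W' (u, v) k := W'le (u, v) 0%N k cuv (leq0n k).
have uk1 : u <= W (u, v) k.+1 := W'le (u, v) 0%N k.+2 cuv (leq0n _).
apply: (contr2 (k %% 5).+3 t') => //=; first exact: lt_trans kP kt'.
  apply: (@push_gt _ _ _ _ (W' (u, v) k) (W (u, v) k.+1)) => //.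
  - by move=> /PcU.
  - by move=> /NcU.
  - move=> y ky yk; have [||Uy ey] := eE _ _ y cuv.
    + exact: le_lt_trans uk ky.
    + exact: lt_le_trans yk (Wv _).
    + by split=> //; exists k; rewrite ey.
apply: (@push_lt _ _ _ _ (W (u, v) k.+1) (W (u, v) k.+4)) => //.
- by move=> /PcU.
- by move=> /NcU.
- move=> y ky yk; have [||Uy ey] := eE _ _ y cuv.
  + exact: le_lt_trans uk1 ky.
  + exact: lt_le_trans yk (Wv _).
  + by split=> //; exists k; rewrite ey.
Qed.

End Tests.

(** * Reflection of the unit interval *)

Section Reflection.
Variable R : realType.
Implicit Types (Q : R -> R -> Prop) (f : R -> R) (a b p q s t u v x y z : R).
Implicit Types (c : quad R) (T : set (quad R)) (L : nat -> R -> R) (n : nat).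

Definition reflect_intervals Q a b := Q (1 - b) (1 - a).

Definition reflect_quad c : quad R :=
  ((1 - c.2.2, 1 - c.2.1), (1 - c.1.2, 1 - c.1.1)).

Definition reflect_map f x := 1 - f (1 - x).

Lemma reflect_quadK : involutive reflect_quad.
Proof. by move=> [[x x'] [y y']]; rewrite /reflect_quad /= !subKr. Qed.

Lemma reflect_intervalsK Q : reflect_intervals (reflect_intervals Q) = Q.
Proof.
apply/funext => a; apply/funext => b.
by rewrite /reflect_intervals !subKr.
Qed.

Lemma reflect_subunit Q : subunit Q -> subunit (reflect_intervals Q).
Proof. by move=> HQ a b /HQ[? ? ?]; split; lra. Qed.

Lemma fits_reflect Q s t : fits Q s t -> fits (reflect_intervals Q) (1 - t) (1 - s).
Proof.
move=> [a [b [Qab sa tb]]]; exists (1 - b), (1 - a); split; try lra.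
by rewrite /reflect_intervals !subKr.
Qed.

Lemma fits_inside_reflect Q s t : fits_inside Q s t ->
  fits_inside (reflect_intervals Q) (1 - t) (1 - s).
Proof.
move=> [a [b [Qab sa tb]]]; exists (1 - b), (1 - a); split; try lra.
by rewrite /reflect_intervals !subKr.
Qed.

Lemma fits_insideE Q s t :
  fits_inside (reflect_intervals Q) s t = fits_inside Q (1 - t) (1 - s).
Proof.
apply/propext; split=> /fits_inside_reflect; first by rewrite reflect_intervalsK.
by rewrite !subKr.
Qed.

Lemma component_reflect Q u v : component Q u v ->
  component (reflect_intervals Q) (1 - v) (1 - u).
Proof.
move=> [cu cv uv H]; split; rewrite ?fits_insideE ?subKr //; first lra.
by move=> z zu zv; rewrite fits_insideE; apply: H; lra.
Qed.

Lemma unit_iso_reflect f : unit_iso f -> unit_iso (reflect_map f).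
Proof.
move=> [f0 f1 fm fs]; rewrite /reflect_map; split.
- by rewrite subr0 f1 subrr.
- by rewrite subrr f0 subr0.
- move=> x y x0 y1 xy.
  have : f (1 - y) < f (1 - x) by apply: fm; lra.
  lra.
- move=> y y0 y1; have [||x [x0 x1 fx]] := fs (1 - y); try lra.
  by exists (1 - x); rewrite subKr fx subKr; split; lra.
Qed.

Lemma fits_image_reflect Q f a b : fits (image_intervals (reflect_map f) Q) a b ->
  fits (image_intervals f (reflect_intervals Q)) (1 - b) (1 - a).
Proof.
move=> [_ [_ [[a0 [b0 [Qab -> ->]]] aa bb]]]; rewrite /reflect_map in aa bb.
exists (f (1 - b0)), (f (1 - a0)); split; try lra.
by exists (1 - b0), (1 - a0); rewrite /reflect_intervals !subKr.
Qed.

Lemma test_system_reflect Q n L T : test_system (reflect_intervals Q) n L T ->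
  test_system Q n (fun i => reflect_map (L i)) (reflect_quad @` T).
Proof.
move=> [Liso Tc Tv Tf]; split.
- by move=> i ni; apply: unit_iso_reflect; apply: Liso.
- exact: sub_countable (card_image_le _ _) Tc.
- by move=> _ [c /Tv[x1 x2 x3 x4 x5] <-]; split=> /=; lra.
- move=> a b ab H; have := Tf (1 - b) (1 - a) ltac:(lra).
  move=> /(_ (fun i ni => fits_image_reflect (H i ni))) /(finite_image reflect_quad).
  apply: sub_finite_set => _ [[c Tc' <-] [/= t1 t2]]; exists c => //.
  by split=> //; split; lra.
Qed.

Lemma test_system_union Q n L T n' L' T' : test_system Q n L T ->
  test_system Q n' L' T' ->
  test_system Q (n + n') (fun i => if (i < n)%N then L i else L' (i - n)%N) (T `|` T').
Proof.
move=> [Liso Tc Tv Tf] [Liso' Tc' Tv' Tf']; split.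
- move=> i ni; case: ifPn => h; first exact: Liso.
  by apply: Liso'; rewrite -leqNgt in h; rewrite ltn_subLR.
- have -> : T `|` T' = \bigcup_(b in [set: bool]) (if b then T else T').
    by apply/seteqP; split=> [c [h|h]|c [[] _ h]];
      [exists true|exists false|left|right].
  by apply: bigcup_countable => [|[] _] //; exact: countableP.
- by move=> c [/Tv|/Tv'].
- move=> a b ab H; rewrite setIUl finite_setU; split.
    by apply: Tf => // i ni; have := H i (ltn_addr _ ni); rewrite ni.
  apply: Tf' => // i ni; have := H (n + i)%N; rewrite ltn_add2l => /(_ ni).
  by rewrite ltnNge leq_addr /= addKn.
Qed.

(** A bad interval without a cut point lies in one component. If it ends at the right end of the
    component, or lies in the left half, its reflection has a position treated in
    [half_test_system]; otherwise the interval itself has one. The union of the two systems serves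
    both cases. *)
Lemma test_system_ex Q : subunit Q -> exists n L T, test_system Q n L T /\
  forall s t, 0 <= s -> t <= 1 -> s < t -> ~ fits Q s t ->
    infinite_set (T `&` inside s t).
Proof.
move=> HQ; have [n [L [T [LT HT]]]] := half_test_system HQ.
have [n' [L' [T' [LT' HT']]]] := half_test_system (reflect_subunit HQ).
have := test_system_union LT (test_system_reflect LT').
set N := (n + n')%N; set LL := (fun i => _) => LLT.
exists N, LL, (T `|` reflect_quad @` T'); split=> // s t s0 t1 st nF.
have case1 : infinite_set (T `&` inside s t) ->
    infinite_set ((T `|` reflect_quad @` T') `&` inside s t).
  by apply: infinite_subset => c [? ?]; split=> //; left.
have case2 : infinite_set (T' `&` inside (1 - t) (1 - s)) ->
    infinite_set ((T `|` reflect_quad @` T') `&` inside s t).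
  move=> h fin; apply: h; have := finite_image reflect_quad fin.
  apply: sub_finite_set => c [Tc [c1 c2]]; exists (reflect_quad c).
    split; first by right; exists c.
    by split=> /=; lra.
  exact: reflect_quadK.
have nF' : ~ fits (reflect_intervals Q) (1 - t) (1 - s).
  by move=> /fits_reflect; rewrite reflect_intervalsK !subKr.
have [[z [sz zt nz]]|ncut] :=
  pselect (exists z, [/\ s < z, z < t & ~ fits_inside Q z z]).
  by apply: case1; apply: HT => //; left; exists z.
have H z : s < z -> z < t -> fits_inside Q z z.
  by move=> sz zt; apply: contrapT => nz; apply: ncut; exists z.
have Hm : fits_inside Q ((s + t) / 2) ((s + t) / 2) by apply: H; lra.
have [u [v [cuv um mv]]] := component_ex HQ Hm.
have us : u <= s.
  by rewrite leNgt; apply/negP => su; case: cuv => cu _ _ _; apply: cu; apply: H; lra.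
have tv : t <= v.
  by rewrite leNgt; apply/negP => su; case: cuv => _ cv _ _; apply: cv; apply: H; lra.
have cvu := component_reflect cuv.
have [su|su] := eqVneq s u.
  by apply: case1; apply: HT => //; right; exists u, v; split=> //; apply: Or31.
have [tv'|tv'] := eqVneq t v.
  apply: case2; apply: HT' => //; try lra.
  by right; exists (1 - v), (1 - u); split=> //; apply: Or31; rewrite tv'; split; lra.
have {}us : u < s by rewrite lt_neqAle eq_sym su.
have {}tv : t < v by rewrite lt_neqAle tv'.
have [tm|mt] := leP t ((u + v) / 2).
  apply: case2; apply: HT' => //; try lra.
  right; exists (1 - v), (1 - u); split=> //; apply: Or33; split; lra.
have [ms|sm] := leP ((u + v) / 2) s.
  by apply: case1; apply: HT => //; right; exists u, v; split=> //; apply: Or33.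
by apply: case1; apply: HT => //; right; exists u, v; split=> //; apply: Or32.
Qed.

End Reflection.

(** * Norms and orthogonal series *)

Local Open Scope complex_scope.

Section RealNorm.
Variables (R : realType) (V : normedModType R[i]).
Implicit Types (x y : V) (c : R[i]).

(** The norm takes values in [R[i]]; its real part makes real suprema and linear arithmetic
    available. *)
Definition rnorm x : R := complex.Re `|x|.

Lemma complex_ge0E c : 0 <= c -> c = (complex.Re c)%:C.
Proof. by case: c => a b; rewrite lecE /= => /andP[/eqP -> _]. Qed.

Lemma rnormE x : `|x| = (rnorm x)%:C.
Proof. by apply: complex_ge0E; exact: normr_ge0. Qed.

Lemma rnorm_ge0 x : 0 <= rnorm x.
Proof. by rewrite -lecR -rnormE; apply: normr_ge0. Qed.

Lemma rnorm0 : rnorm 0 = 0. Proof. by rewrite /rnorm normr0. Qed.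

Lemma rnormN x : rnorm (- x) = rnorm x. Proof. by rewrite /rnorm normrN. Qed.

Lemma rnorm_distC x y : rnorm (x - y) = rnorm (y - x).
Proof. by rewrite /rnorm distrC. Qed.

Lemma rnormD x y : rnorm (x + y) <= rnorm x + rnorm y.
Proof. by rewrite -lecR rmorphD /= -!rnormE ler_normD. Qed.

Lemma rnorm_distD z x y : rnorm (x - y) <= rnorm (x - z) + rnorm (z - y).
Proof. by rewrite -lecR rmorphD /= -!rnormE ler_distD. Qed.

Lemma rnorm_eq0 x : rnorm x = 0 -> x = 0.
Proof. by move=> h; apply/eqP; rewrite -normr_eq0 rnormE h. Qed.

Lemma rnormZ c x : rnorm (c *: x) = complex.Re `|c| * rnorm x.
Proof.
apply: (@complexI R); rewrite rmorphM /= -!rnormE normrZ.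
by rewrite [X in X * _ = _]complex_ge0E.
Qed.

Lemma rnorm_le1 x : (`|x| <= 1) = (rnorm x <= 1).
Proof. by rewrite rnormE -[1]/(1%:C) lecR. Qed.

End RealNorm.

Section SeqLim.
Variables (R : realType) (V : completeNormedModType R[i]).
Implicit Types (x y : V) (S : nat -> V).

Definition seq_lim S y := forall e : R, 0 < e ->
  exists N, forall n, (N <= n)%N -> rnorm (S n - y) < e.

Lemma complex_gt0E (e : R[i]) : 0 < e -> exists2 r : R, 0 < r & e = r%:C.
Proof.
move=> e0; have eE := complex_ge0E (ltW e0); exists (complex.Re e) => //.
by move: e0; rewrite eE ltcR.
Qed.

Lemma seq_lim_cvg S y : seq_lim S y -> S @ \oo --> y.
Proof.
move=> h; apply/cvgrPdist_lt => e /complex_gt0E[r r0 ->].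
have [N hN] := h _ r0; exists N => // n /= Nn.
by rewrite distrC rnormE ltcR; apply: hN.
Qed.

Lemma seq_lim_ex S :
  (forall e : R, 0 < e -> exists N, forall n, (N <= n)%N -> rnorm (S n - S N) < e) ->
  exists y, seq_lim S y.
Proof.
move=> h; have : cauchy (S @ \oo).
  apply: cauchy_exP => e /complex_gt0E[r r0 ->].
  have [N hN] := h _ r0; exists (S N); exists N => // n /= Nn.
  by rewrite -ball_normE /= distrC rnormE ltcR; apply: hN.
move=> /cauchy_cvg; move=> /cvg_ex[y /cvgrPdist_lt Sy]; exists y => e e0.
have e0' : 0 < e%:C :> R[i] by rewrite ltcR.
have [N _ hN] := Sy _ e0'; exists N => n Nn.
by have := hN _ Nn; rewrite /= distrC rnormE ltcR.
Qed.

Lemma seq_lim_uniq S x y : seq_lim S x -> seq_lim S y -> x = y.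
Proof.
move=> hx hy; apply/eqP; rewrite -subr_eq0; apply/eqP/rnorm_eq0.
apply/eqP; rewrite eq_le rnorm_ge0 andbT; apply/ler_addgt0Pl => e e0.
have e2 : 0 < e / 2 by lra.
have [N hN] := hx _ e2; have [M hM] := hy _ e2.
have := hN (maxn N M) (leq_maxl _ _); have := hM (maxn N M) (leq_maxr _ _).
have := rnorm_distD (S (maxn N M)) x y; rewrite (rnorm_distC x (S _)); lra.
Qed.

Lemma seq_limD S S' x y : seq_lim S x -> seq_lim S' y ->
  seq_lim (fun n => S n + S' n) (x + y).
Proof.
move=> hx hy e e0; have e2 : 0 < e / 2 by lra.
have [N hN] := hx _ e2; have [M hM] := hy _ e2.
exists (maxn N M) => n; rewrite geq_max => /andP[/hN h1 /hM h2].
have -> : S n + S' n - (x + y) = (S n - x) + (S' n - y).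
  by rewrite opprD addrACA.
by have := rnormD (S n - x) (S' n - y); lra.
Qed.

Lemma seq_lim_norm_le S x r : seq_lim S x -> (forall n, rnorm (S n) <= r) ->
  rnorm x <= r.
Proof.
move=> hx Sr; apply/ler_addgt0Pl => e e0; have [N hN] := hx _ e0.
have := hN _ (leqnn N); have := Sr N; have := rnorm_distD (S N) x 0.
rewrite !subr0 (rnorm_distC x (S _)); lra.
Qed.

Lemma seq_lim_const_tail S x N : (forall n, (N <= n)%N -> S n = S N) ->
  seq_lim S x -> x = S N.
Proof.
move=> h hx; apply: (seq_lim_uniq hx) => e e0; exists N => n /h ->.
by rewrite subrr rnorm0.
Qed.

End SeqLim.

(** * Bounded operators *)

Section Bounded.
Variables (R : realType) (H : completeNormedModType R[i]).
Implicit Types (x y : H) (S : nat -> H) (T K : H -> H).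

Lemma bounded_operatorP T : bounded_operator T <->
  linear T /\ exists2 d : R, 0 < d & forall x, rnorm (T x) <= d * rnorm x.
Proof.
split=> [[Tl [c Tc]]|[Tl [d d0 Td]]]; split=> //; last first.
  by exists d%:C => x; rewrite !rnormE -rmorphM lecR Td.
(* The given bound [c] is an arbitrary complex number; adding 1 to its modulus makes the real bound
   positive. *)
exists (complex.Re `|c| + 1).
  by rewrite ltr_wpDl // -lecR -complex_ge0E ?normr_ge0.
move=> x; apply: (@le_trans _ _ (complex.Re `|c| * rnorm x)); last first.
  by rewrite ler_wpM2r ?rnorm_ge0 // lerDl.
rewrite -lecR rmorphM /= -!rnormE.
have h := Tc x; have h0 : 0 <= c * `|x| by apply: le_trans h; apply: normr_ge0.
by rewrite (le_trans h) // -[leLHS]ger0_norm // normrM normr_id.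
Qed.

Lemma bounded_operator_intro T (d : R) : linear T ->
  (forall x, rnorm (T x) <= d * rnorm x) -> bounded_operator T.
Proof.
move=> Tl Td; split=> //; exists d%:C => x.
by rewrite !rnormE -rmorphM lecR Td.
Qed.

Section Linear.
Variable T : H -> H.
Hypothesis Tl : linear T.

Lemma op0 : T 0 = 0.
Proof. by have := Tl (-1) 0 0; rewrite scaleN1r addNr scaleN1r addNr. Qed.

Lemma opD x y : T (x + y) = T x + T y.
Proof. by have := Tl 1 x y; rewrite !scale1r. Qed.

Lemma opZ (a : R[i]) x : T (a *: x) = a *: T x.
Proof. by have := Tl a x 0; rewrite !addr0 op0 addr0. Qed.

Lemma opN x : T (- x) = - T x.
Proof. by rewrite -scaleN1r opZ scaleN1r. Qed.

Lemma opB x y : T (x - y) = T x - T y.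
Proof. by rewrite opD opN. Qed.

Lemma op_sum (I : Type) (r : seq I) (F : I -> H) :
  T (\sum_(i <- r) F i) = \sum_(i <- r) T (F i).
Proof.
by elim: r => [|i r IH]; rewrite ?big_nil ?op0 // !big_cons opD IH.
Qed.

End Linear.

Lemma seq_lim_bounded S x T : bounded_operator T -> seq_lim S x ->
  seq_lim (fun n => T (S n)) (T x).
Proof.
move=> /bounded_operatorP[Tl [d d0 Td]] hx e e0.
have [N hN] := hx (e / d) (divr_gt0 e0 d0).
exists N => n /hN h; rewrite -(opB Tl); apply: le_lt_trans (Td _) _.
by rewrite mulrC -ltr_pdivlMr.
Qed.

Lemma bounded_operator_comp T K : bounded_operator T -> bounded_operator K ->
  bounded_operator (T \o K).
Proof.
move=> /bounded_operatorP[Tl [d d0 Td]] /bounded_operatorP[Kl [c c0 Kc]].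
apply: (@bounded_operator_intro _ (d * c)) => [a x y|x] /=.
  by rewrite Kl Tl.
by rewrite (le_trans (Td _)) // -mulrA ler_pM2l.
Qed.

Lemma bounded_operatorB T K : bounded_operator T -> bounded_operator K ->
  bounded_operator (T \- K).
Proof.
move=> /bounded_operatorP[Tl [d d0 Td]] /bounded_operatorP[Kl [c c0 Kc]].
apply: (@bounded_operator_intro _ (d + c)) => [a x y|x] /=.
  by rewrite Kl Tl scalerBr opprD addrACA.
rewrite mulrDl (le_trans (rnormD _ _)) // rnormN lerD //.
Qed.

Lemma bounded_operatorD T K : bounded_operator T -> bounded_operator K ->
  bounded_operator (T \+ K).
Proof.
move=> /bounded_operatorP[Tl [d d0 Td]] /bounded_operatorP[Kl [c c0 Kc]].
apply: (@bounded_operator_intro _ (d + c)) => [a x y|x] /=.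
  by rewrite Kl Tl scalerDr addrACA.
by rewrite mulrDl (le_trans (rnormD _ _)) // lerD.
Qed.

Lemma bounded_operatorZ (c : R[i]) : bounded_operator (fun x : H => c *: x).
Proof.
apply: (@bounded_operator_intro _ (complex.Re `|c|)) => [k x y|x].
  by rewrite scalerDr !scalerA mulrC.
by rewrite rnormZ.
Qed.

Lemma bounded_operator0 : bounded_operator (\0 : H -> H).
Proof.
apply: (@bounded_operator_intro _ 0) => [a x y|x] /=; first by rewrite scaler0 addr0.
by rewrite rnorm0 mul0r.
Qed.

End Bounded.

(** * Pythagoras and Bessel *)

Section Hilbert.
Variables (R : realType) (H : completeNormedModType R[i]).
Variable dot : {dot H for Num.conj}.
Hypothesis Hdot : induces_norm dot.
Implicit Types (x y z : H) (a b : nat -> H) (c : nat -> R[i]).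

Definition sq x : R := rnorm x ^+ 2.

Lemma sq_ge0 x : 0 <= sq x. Proof. exact: sqr_ge0. Qed.

Lemma sqE x : dot x x = (sq x)%:C.
Proof. by rewrite -Hdot rnormE -rmorphXn. Qed.

Lemma dotDl x y z : dot (x + y) z = dot x z + dot y z.
Proof. exact: linearDl. Qed.

Lemma dotDr x y z : dot z (x + y) = dot z x + dot z y.
Proof. exact: linearDr. Qed.

Lemma dotNl x z : dot (- x) z = - dot x z.
Proof. exact: linearNl. Qed.

Lemma dotNr x z : dot z (- x) = - dot z x.
Proof. exact: linearNr. Qed.

Lemma dot0l z : dot 0 z = 0.
Proof. exact: linear0l. Qed.

Lemma dot0r z : dot z 0 = 0.
Proof. exact: linear0r. Qed.

Lemma dotZl (k : R[i]) x z : dot (k *: x) z = k * dot x z.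
Proof. exact: linearZl_LR. Qed.

Lemma dotZr (k : R[i]) x z : dot z (k *: x) = (k^*)%R * dot z x.
Proof. exact: linearZr_LR. Qed.

Lemma dotC x y : dot x y = ((dot y x)^*)%R.
Proof. by rewrite hermC /= expr0 mul1r. Qed.

Lemma dot_eq0C x y : dot x y = 0 -> dot y x = 0.
Proof. by move=> h; rewrite dotC h rmorph0. Qed.

Lemma sqD_orth x y : dot x y = 0 -> sq (x + y) = sq x + sq y.
Proof.
move=> h; apply: (@complexI R); rewrite rmorphD /= -!sqE dotDl !dotDr h.
by rewrite (dot_eq0C h) addr0 add0r.
Qed.

Definition csq (k : R[i]) : R := complex.Re `|k| ^+ 2.

Lemma csqE (k : R[i]) : (csq k)%:C = k * (k^*)%R.
Proof. by rewrite -normCK [in RHS](complex_ge0E (normr_ge0 k)) -rmorphXn. Qed.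

Lemma csq_ge0 (k : R[i]) : 0 <= csq k. Proof. exact: sqr_ge0. Qed.

Lemma sqZ (k : R[i]) x : sq (k *: x) = csq k * sq x.
Proof. by rewrite /sq rnormZ exprMn. Qed.

Lemma dot_suml (I : Type) (r : seq I) (F : I -> H) z :
  dot (\sum_(i <- r) F i) z = \sum_(i <- r) dot (F i) z.
Proof.
by elim: r => [|i r IH]; rewrite ?big_nil ?dot0l // !big_cons dotDl IH.
Qed.

Lemma dot_sumr (I : Type) (r : seq I) (F : I -> H) z :
  dot z (\sum_(i <- r) F i) = \sum_(i <- r) dot z (F i).
Proof.
by elim: r => [|i r IH]; rewrite ?big_nil ?dot0r // !big_cons dotDr IH.
Qed.

Lemma sq0 : sq 0 = 0. Proof. by rewrite /sq rnorm0 expr0n. Qed.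

Lemma pythagoras a c m n : (forall i j, i <> j -> dot (a i) (a j) = 0) ->
  (forall i, sq (a i) <= 1) ->
  sq (\sum_(m <= i < n) c i *: a i) <= \sum_(m <= i < n) csq (c i).
Proof.
move=> orth a1; elim: n => [|n IH].
  by rewrite !big_geq // sq0.
have [nm|mn] := ltnP n m; first by rewrite !big_geq // sq0.
rewrite !big_nat_recr //= sqD_orth ?lerD //.
  by rewrite sqZ ler_piMr ?csq_ge0.
rewrite dotZr dot_suml big_seq big1 ?mulr0 // => i.
rewrite mem_index_iota => /andP[_ ni]; rewrite dotZl orth ?mulr0 //.
by move=> e; rewrite e ltnn in ni.
Qed.

(** With [S] the sum of the [dot x (b i) *: b i], expand [sq (x - S) >= 0] and bound [sq S] by
    [pythagoras]. *)
Lemma bessel b x n : (forall i j, i <> j -> dot (b i) (b j) = 0) ->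
  (forall i, sq (b i) <= 1) ->
  \sum_(0 <= i < n) csq (dot x (b i)) <= sq x.
Proof.
move=> orth b1; set be := (X in X <= _).
pose S := \sum_(0 <= i < n) dot x (b i) *: b i.
have hS : sq S <= be by exact: pythagoras.
have xS : dot x S = be%:C.
  rewrite dot_sumr raddf_sum; apply: eq_bigr => i _.
  by rewrite dotZr [RHS]csqE mulrC.
have : sq (x - S) = sq x - be - be + sq S.
  apply: (@complexI R); rewrite !(rmorphD, rmorphN, rmorphB) /= -!sqE -xS.
  rewrite dotDl !dotDr !dotNl !dotNr opprK (dotC S x) xS.
  have -> : ((be%:C)^*)%R = be%:C :> R[i] 
    by apply/conj_Creal/ger0_real; rewrite lecR; apply: sumr_ge0 => i _; exact: csq_ge0.
  by rewrite !addrA.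
have := sq_ge0 (x - S); lra.
Qed.

(** Cauchy-Schwarz, as the inequality of Bessel for [y] followed by zeros. *)
Lemma csq_dot_le x y : sq y <= 1 -> csq (dot x y) <= sq x.
Proof.
move=> y1; pose b i := if i is 0%N then y else 0.
have := @bessel b x 1; rewrite big_nat1 /=; apply.
  by move=> [|i] [|j] //= _; rewrite ?dot0l ?dot0r.
by case=> [|i] //=; rewrite sq0.
Qed.

End Hilbert.

Section SeriesOperator.
Variables (R : realType) (H : completeNormedModType R[i]).
Variable dot : {dot H for Num.conj}.
Hypothesis Hdot : induces_norm dot.
Implicit Types (x y z : H) (a b : nat -> H).

Lemma sq_lt x (e : R) : 0 < e -> sq x < e ^+ 2 -> rnorm x < e.
Proof. by move=> e0; rewrite /sq ltr_pXn2r // nnegrE ?rnorm_ge0 ?ltW. Qed.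

Lemma sq_le x y : sq x <= sq y -> rnorm x <= rnorm y.
Proof. by rewrite /sq ler_pXn2r // nnegrE rnorm_ge0. Qed.

Lemma sq_eq0 x : sq x = 0 -> x = 0.
Proof. by rewrite /sq => /eqP; rewrite sqrf_eq0 => /eqP /rnorm_eq0. Qed.

(** By Pythagoras the increments of the partial sums are bounded by pieces of the convergent Bessel
    sum, so the partial sums are Cauchy. *)
Lemma series_operator a b :
  (forall i j, i <> j -> dot (a i) (a j) = 0) -> (forall i, sq (a i) <= 1) ->
  (forall i j, i <> j -> dot (b i) (b j) = 0) -> (forall i, sq (b i) <= 1) ->
  exists X : H -> H, [/\ bounded_operator X, forall x, rnorm (X x) <= rnorm x &
    forall x, seq_lim (fun n => \sum_(0 <= i < n) dot x (b i) *: a i) (X x)].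
Proof.
move=> oa a1 ob b1.
have /choice[X XP] : forall x, exists y,
    seq_lim (fun n => \sum_(0 <= i < n) dot x (b i) *: a i) y.
  move=> x; apply: seq_lim_ex => e e0.
  pose s n := \sum_(0 <= i < n) csq (dot x (b i)).
  have sx n : s n <= sq x by exact: bessel.
  have hs : has_sup (range s).
    by split; [exists (s 0%N), 0%N | exists (sq x) => _ [n _ <-]].
  have e20 : 0 < e ^+ 2 by rewrite exprn_gt0.
  have [_ [N _ <-] hN] := sup_adherent e20 hs.
  exists N => n Nn; apply: sq_lt => //.
  have -> : \sum_(0 <= i < n) dot x (b i) *: a i -
      \sum_(0 <= i < N) dot x (b i) *: a i = \sum_(N <= i < n) dot x (b i) *: a i.
    by rewrite (big_cat_nat (leq0n N) Nn) /= addrAC subrr add0r.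
  apply: le_lt_trans (pythagoras Hdot _ _ _ oa a1) _.
  have : s n <= sup (range s) by apply: ub_le_sup; [case: hs | exists n].
  by rewrite /s (big_cat_nat (leq0n N) Nn) /= -/(s N); lra.
have Xx x : rnorm (X x) <= rnorm x.
  apply: (seq_lim_norm_le (XP x)) => n; apply: sq_le.
  by apply: le_trans (pythagoras Hdot _ _ _ oa a1) _; apply: bessel.
exists X; split=> //; apply: (@bounded_operator_intro _ _ _ 1); last first.
  by move=> x; rewrite mul1r.
move=> k x y; apply: (seq_lim_uniq (XP _)).
have := seq_limD (seq_lim_bounded (bounded_operatorZ H k) (XP x)) (XP y).
congr seq_lim; apply/funext => n; rewrite scaler_sumr -big_split /=.
by apply: eq_bigr => i _; rewrite dotDl dotZl scalerDl scalerA.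
Qed.

End SeriesOperator.

(** * Orthogonal projections and their order *)

Section Projections.
Variables (R : realType) (H : completeNormedModType R[i]).
Variable dot : {dot H for Num.conj}.
Hypothesis Hdot : induces_norm dot.
Implicit Types (x y z : H) (E F M N : H -> H).

Lemma projB E : orth_projection dot E -> forall x y, E (x - y) = E x - E y.
Proof. by move=> [[El _] _ _] x y; rewrite (opB El). Qed.

Lemma proj_idem E x : orth_projection dot E -> E (E x) = E x.
Proof. by move=> [_ EE _]; rewrite -[in RHS]EE. Qed.

Lemma proj_dot E x : orth_projection dot E -> dot (E x) x = (sq (E x))%:C.
Proof. by move=> pE; rewrite -(sqE Hdot) -{1}(proj_idem x pE); case: pE. Qed.

Lemma proj_sq E x : orth_projection dot E -> sq x = sq (E x) + sq (x - E x).
Proof.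
move=> pE; have [_ _ sa] := pE.
have h : dot (E x) (x - E x) = 0.
  by rewrite dotDr dotNr -[dot (E x) (E x)]sa proj_idem // subrr.
by rewrite -(sqD_orth Hdot h) addrC subrK.
Qed.

Lemma proj_norm E x : orth_projection dot E -> rnorm (E x) <= rnorm x.
Proof.
by move=> pE; apply: sq_le; rewrite (proj_sq x pE) lerDl sq_ge0.
Qed.

Lemma proj_bounded E : orth_projection dot E -> bounded_operator E.
Proof. by case. Qed.

Lemma dot_ext x y : (forall z, dot x z = dot y z) -> x = y.
Proof.
move=> h; apply/eqP; rewrite -subr_eq0; apply/eqP/sq_eq0/(@complexI R).
by rewrite -(sqE Hdot) dotDl dotNl h subrr.
Qed.

Lemma op_le_sq E F x : orth_projection dot E -> orth_projection dot F ->
  op_le dot E F -> sq (E x) <= sq (F x).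
Proof. by move=> pE pF /(_ x); rewrite !proj_dot // lecR. Qed.

(** [F] kills [y - F y], so the smaller projection [E] does too; the other identity follows by
    taking adjoints. *)
Lemma op_leP E F : orth_projection dot E -> orth_projection dot F ->
  (op_le dot E F <-> forall x, E (F x) = E x /\ F (E x) = E x).
Proof.
move=> pE pF; split=> [EF x|h x]; last first.
  rewrite !proj_dot // lecR -(h x).1.
  by have := proj_norm (F x) pE; rewrite /sq ler_pXn2r ?nnegrE ?rnorm_ge0.
have EFx y : E (F y) = E y.
  have : sq (E (y - F y)) <= 0.
    apply: le_trans (op_le_sq _ pE pF EF) _.
    by rewrite (projB pF) proj_idem // subrr sq0.
  rewrite (projB pE) => h; apply/esym/eqP; rewrite -subr_eq0; apply/eqP.
  by apply: sq_eq0; apply/eqP; rewrite eq_le h sq_ge0.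
split=> //; have [_ _ sE] := pE; have [_ _ sF] := pF.
by apply: dot_ext => z; rewrite sF !sE EFx.
Qed.

Lemma op_leB M N : orth_projection dot M -> orth_projection dot N ->
  op_le dot M N -> orth_projection dot (N \- M).
Proof.
move=> pM pN MN; have {}MN := (op_leP pM pN).1 MN.
have [bM _ sM] := pM; have [bN _ sN] := pN; split.
- exact: bounded_operatorB.
- apply/funext => x /=; rewrite (projB pN) (projB pM) !proj_idem //.
  by rewrite (MN x).1 (MN x).2 subrr subr0.
- by move=> x y /=; rewrite dotDl dotDr dotNl dotNr sM sN.
Qed.

Lemma op_le_antisym M N : orth_projection dot M -> orth_projection dot N ->
  op_le dot M N -> op_le dot N M -> M = N.
Proof.
move=> pM pN MN NM; apply/funext => x.
by rewrite -((op_leP pM pN).1 MN x).1 ((op_leP pN pM).1 NM x).2.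
Qed.

End Projections.

(** * Compact operators and the essential norm *)

Section Compact.
Variables (R : realType) (H : completeNormedModType R[i]).
Variable dot : {dot H for Num.conj}.
Hypothesis Hdot : induces_norm dot.
Implicit Types (x y z : H) (E F K T X : H -> H) (e : R).

Local Notation unit_ball := [set x : H | `|x| <= 1].

Lemma compact_operator_sub K (A : set H) : bounded_operator K -> compact A ->
  K @` unit_ball `<=` A -> compact_operator K.
Proof.
move=> bK cA KA; split=> //; apply: precompact_subset KA _.
by apply: compact_precompact => //; exact: norm_hausdorff.
Qed.

Lemma continuous_bounded T : bounded_operator T -> continuous T.
Proof.
move=> /bounded_operatorP[Tl [d d0 Td]] x; apply/cvgrPdist_lt => e /complex_gt0E[r r0 ->].
near=> y; rewrite -(opB Tl) rnormE ltcR; apply: le_lt_trans (Td _) _.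
rewrite mulrC -ltr_pdivlMr // -ltcR -rnormE; near: y.
have h : 0 < (r / d)%:C :> R[i] by rewrite ltcR divr_gt0.
by move: (_%:C) h => d' h; apply/nbhs_ballP; exists d' => // y; rewrite -ball_normE.
Unshelve. all: by end_near.
Qed.

Lemma compact_operator_image K : compact_operator K ->
  exists2 A : set H, compact A & forall x, rnorm x <= 1 -> A (K x).
Proof.
move=> [bK]; rewrite precompactE => cA; exists (closure (K @` unit_ball)) => //.
by move=> x x1; apply: subset_closure; exists x => //=; rewrite rnorm_le1.
Qed.

Lemma compact_operatorI K (A : set H) : bounded_operator K -> compact A ->
  (forall x, rnorm x <= 1 -> A (K x)) -> compact_operator K.
Proof.
move=> bK cA KA; apply: (compact_operator_sub bK cA).
by move=> _ [x /= x1 <-]; apply: KA; rewrite -rnorm_le1.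
Qed.

Lemma compact_operator0 : compact_operator (\0 : H -> H).
Proof.
apply: (@compact_operatorI _ [set (0 : H)]) => //; first exact: bounded_operator0.
exact: compact_set1.
Qed.

Lemma compact_operatorD K T : compact_operator K -> compact_operator T ->
  compact_operator (K \+ T).
Proof.
move=> cK cT; have [A cA KA] := compact_operator_image cK.
have [B cB TB] := compact_operator_image cT.
apply: (@compact_operatorI _ ((fun p : H * H => p.1 + p.2) @` (A `*` B))).
- by apply: bounded_operatorD; [case: cK | case: cT].
- apply: continuous_compact; last exact: compact_setX.
  by apply: continuous_subspaceT => p; exact: add_continuous.
- by move=> x x1; exists (K x, T x) => //; split; [apply: KA | apply: TB].
Qed.

Lemma compact_operator_sandwich E K : bounded_operator E ->
  (forall x, rnorm (E x) <= rnorm x) -> compact_operator K ->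
  compact_operator (E \o K \o E).
Proof.
move=> bE E1 cK; have [A cA KA] := compact_operator_image cK.
apply: (@compact_operatorI _ (E @` A)).
- apply: bounded_operator_comp => //; apply: bounded_operator_comp => //.
  by case: cK.
- apply: continuous_compact => //; apply: continuous_subspaceT.
  exact: continuous_bounded.
- by move=> x x1; exists (K (E x)) => //; apply: KA; apply: le_trans (E1 x) _.
Qed.

(** The unit ball is mapped into the continuous image of a compact square of coefficients. *)
Lemma compact_rank_one x0 y0 : sq y0 <= 1 ->
  compact_operator (fun x => dot x y0 *: x0).
Proof.
move=> y1; pose f (p : R * R) := (p.1 +i* p.2) *: x0.
have csqE' (k : R[i]) : csq k = complex.Re k ^+ 2 + complex.Im k ^+ 2.
  by apply: (@complexI R); rewrite csqE; case: k => a b; simpc; congr (_ +i* _); ring.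
have ck x : rnorm x <= 1 -> csq (dot x y0) <= 1.
  move=> x1; apply: le_trans (csq_dot_le Hdot x y1) _.
  by rewrite /sq expr_le1 // rnorm_ge0.
have bK : bounded_operator (fun x => dot x y0 *: x0).
  apply: (@bounded_operator_intro _ _ _ (rnorm x0)) => [k x y|x].
    by rewrite dotDl dotZl scalerDl scalerA.
  rewrite rnormZ mulrC ler_wpM2l ?rnorm_ge0 //.
  have := csq_dot_le Hdot x y1; rewrite /csq /sq ler_pXn2r ?nnegrE ?rnorm_ge0 //.
  exact: (rnorm_ge0 (dot x y0 : R[i]^o)).
apply: (@compact_operatorI _ (f @` (`[-1, 1]%classic `*` `[-1, 1]%classic))) => //.
  apply: continuous_compact; last by apply: compact_setX; exact: segment_compact.
  apply: continuous_subspaceT => p.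
  apply/cvgrPdist_lt => e /complex_gt0E[r r0 ->].
  pose c := rnorm x0 + 1; have c0 : 0 < c by rewrite ltr_wpDl ?rnorm_ge0.
  have h : 0 < r / (2 * c) by rewrite divr_gt0 // mulr_gt0.
  near=> q; rewrite rnormE ltcR /f -scalerBl rnormZ.
  have [q1 q2] : `|p.1 - q.1| < r / (2 * c) /\ `|p.2 - q.2| < r / (2 * c).
    split; near: q.
      exact: (@cvgr_dist_lt _ _ _ _ _ _ p.1 (@cvg_fst _ _ _ _ _) _ h).
    exact: (@cvgr_dist_lt _ _ _ _ _ _ p.2 (@cvg_snd _ _ _ _ _) _ h).
  have n1 : rnorm x0 < c by rewrite /c ltrDl.
  set k := _ - _.
  have ke : complex.Re `|k| <= `|p.1 - q.1| + `|p.2 - q.2|.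
    rewrite -(ler_pXn2r (_ : 0 < 2)%N) ?nnegrE ?addr_ge0 //; last first.
      exact: (rnorm_ge0 (k : R[i]^o)).
    rewrite -[_ ^+ 2]/(csq k) csqE' /k /=.
    have := mulr_ge0 (normr_ge0 (p.1 - q.1)) (normr_ge0 (p.2 - q.2)).
    rewrite -[X in X + _ <= _](real_normK (num_real _)) -[X in _ + X <= _](real_normK (num_real _)).
    by move: `|_| `|_| => u v uv; nra.
  have kr : complex.Re `|k| < r / c.
    have -> : r / c = r / (2 * c) + r / (2 * c).
      by field; rewrite lt0r_neq0.
    by rewrite (le_lt_trans ke) // ltrD.
  rewrite -(divfK (lt0r_neq0 c0) r); have := rnorm_ge0 x0.
  have := rnorm_ge0 (k : R[i]^o); rewrite -[rnorm _]/(complex.Re `|k|).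
  move: (r / c) (complex.Re _) kr n1 => A B *; nra.
move=> x x1; exists (complex.Re (dot x y0), complex.Im (dot x y0)); last first.
  by rewrite /f /=; case: (dot x y0).
have := ck x x1; rewrite csqE' => h.
have [] : complex.Re (dot x y0) ^+ 2 <= 1 /\ complex.Im (dot x y0) ^+ 2 <= 1.
  by have := sqr_ge0 (complex.Re (dot x y0)); have := sqr_ge0 (complex.Im (dot x y0)); lra.
have sqr1 (u : R) : u ^+ 2 <= 1 -> -1 <= u <= 1.
  by rewrite -(real_normK (num_real u)) expr_le1 // ler_norml.
move=> /sqr1 h1 /sqr1 h2.
by split => /=; rewrite in_itv.
Unshelve. all: by end_near.
Qed.

Lemma compact_operator_sum (I : Type) (r : seq I) (K : I -> H -> H) :
  (forall i, compact_operator (K i)) ->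
  compact_operator (fun x => \sum_(i <- r) K i x).
Proof.
move=> cK; elim: r => [|i r IH].
  rewrite (_ : (fun x => _) = \0); first exact: compact_operator0.
  by apply/funext => x; rewrite big_nil.
rewrite (_ : (fun x => _) = K i \+ (fun x => \sum_(j <- r) K j x)).
  exact: compact_operatorD.
by apply/funext => x; rewrite big_cons.
Qed.

Lemma op_norm_has_sup T : bounded_operator T ->
  has_sup [set complex.Re `|T x| | x in unit_ball].
Proof.
move=> /bounded_operatorP[Tl [d d0 Td]]; split.
  by exists (complex.Re `|T 0|), 0 => //=; rewrite normr0 ler01.
exists d => _ [x /= x1 <-]; apply: (le_trans (Td x)).
by rewrite -[leRHS]mulr1 ler_pM2l // -rnorm_le1.
Qed.

Lemma op_norm_ub T x : bounded_operator T -> rnorm x <= 1 ->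
  rnorm (T x) <= op_norm T.
Proof.
move=> bT x1; apply: ub_le_sup; first by case: (op_norm_has_sup bT).
by exists x => //=; rewrite rnorm_le1.
Qed.

Lemma op_norm_le T (c : R) : (forall x, rnorm x <= 1 -> rnorm (T x) <= c) ->
  op_norm T <= c.
Proof.
move=> Tc; apply: ge_sup; last first.
  by move=> _ [x /= x1 <-]; apply: Tc; rewrite -rnorm_le1.
by exists (complex.Re `|T 0|), 0 => //=; rewrite normr0 ler01.
Qed.

Lemma op_norm_ge0 T : bounded_operator T -> 0 <= op_norm T.
Proof.
move=> bT; apply: le_trans (op_norm_ub (x := 0) bT _); first exact: rnorm_ge0.
by rewrite rnorm0.
Qed.

Lemma op_norm_mul T x : bounded_operator T -> rnorm (T x) <= op_norm T * rnorm x.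
Proof.
move=> bT; have [Tl _] := bT.
have [x0|x0] := leP (rnorm x) 0.
  have -> : x = 0 by apply: rnorm_eq0; apply/eqP; rewrite eq_le x0 rnorm_ge0.
  by rewrite (op0 Tl) rnorm0 mulr0.
have kx : complex.Re `|(rnorm x)^-1%:C : R[i]| = (rnorm x)^-1.
  by rewrite ger0_norm // lecR invr_ge0 ltW.
rewrite -ler_pdivrMr // mulrC -kx -rnormZ -(opZ Tl); apply: op_norm_ub => //.
by rewrite rnormZ kx mulVf // gt_eqF.
Qed.

Lemma ess_norm_lbound T : bounded_operator T ->
  lbound [set op_norm (T \- K) | K in @compact_operator R H] 0.
Proof.
by move=> bT _ [K [bK _] <-]; apply: op_norm_ge0; exact: bounded_operatorB.
Qed.

Lemma ess_norm_le T K : bounded_operator T -> compact_operator K ->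
  ess_norm T <= op_norm (T \- K).
Proof.
move=> bT cK; apply: ge_inf; first by exists 0; exact: ess_norm_lbound.
by exists K.
Qed.

Lemma ess_norm_ge T c :
  (forall K, compact_operator K -> c <= op_norm (T \- K)) -> c <= ess_norm T.
Proof.
move=> h; apply: lb_le_inf; last by move=> _ [K cK <-]; exact: h.
by exists (op_norm (T \- \0)), \0 => //; exact: compact_operator0.
Qed.

Lemma ess_norm_ge0 T : bounded_operator T -> 0 <= ess_norm T.
Proof.
move=> bT; apply: ess_norm_ge => K [bK _].
by apply: op_norm_ge0; exact: bounded_operatorB.
Qed.

Lemma ess_norm_le_op T : bounded_operator T -> ess_norm T <= op_norm T.
Proof.
move=> bT; have := ess_norm_le bT compact_operator0.
by congr (_ <= op_norm _); apply/funext => x /=; rewrite subr0.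
Qed.

Lemma ess_norm_compact T : compact_operator T -> ess_norm T = 0.
Proof.
move=> cT; have [bT _] := cT; apply/eqP; rewrite eq_le ess_norm_ge0 // andbT.
apply: le_trans (ess_norm_le bT cT) _; apply: op_norm_le => x _ /=.
by rewrite subrr rnorm0.
Qed.

(** Compressing a compact approximant [K] of [T] gives a compact approximant of the compression that
    is at least as close. *)
Lemma ess_norm_compress E T : bounded_operator E ->
  (forall x, rnorm (E x) <= rnorm x) -> bounded_operator T ->
  ess_norm (E \o T \o E) <= ess_norm T.
Proof.
move=> bE E1 bT; apply: ess_norm_ge => K cK; have [bK _] := cK.
have bETE : bounded_operator (E \o T \o E).
  by do 2!apply: bounded_operator_comp => //.
apply: le_trans (ess_norm_le bETE (compact_operator_sandwich bE E1 cK)) _.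
apply: op_norm_le => x x1 /=; have [El _] := bE.
rewrite -(opB El); apply: le_trans (E1 _) _.
apply: (op_norm_ub (T := T \- K)); first exact: bounded_operatorB.
exact: le_trans (E1 x) x1.
Qed.

(** The sequence [K (b n)] stays in a compact set, so it returns infinitely often to the ball of
    radius [e / 2] around a cluster point. *)
Lemma compact_operator_close K (b : nat -> H) e : compact_operator K ->
  (forall n, rnorm (b n) <= 1) -> 0 < e ->
  exists n m, (n < m)%N /\ rnorm (K (b n) - K (b m)) < e.
Proof.
move=> cK b1 e0; have [A cA KA] := compact_operator_image cK.
have [|z [_ cz]] := cA ((fun n => K (b n)) @ \oo) _.
  by exists 0%N => // n _; apply: KA.
have e2 : 0 < (e / 2)%:C :> R[i] by rewrite ltcR divr_gt0.
have tail N : exists n, (N <= n)%N /\ rnorm (z - K (b n)) < e / 2.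
  have [|_ [[n /= Nn <-]]] := cz ((fun n => K (b n)) @` [set n | (N <= n)%N])
    (ball z (e / 2)%:C) _ (nbhsx_ballx _ _ e2).
    by exists N => // n Nn; exists n.
  by rewrite -ball_normE /= rnormE ltcR => h; exists n.
have [n [_ hn]] := tail 0%N; have [m [nm hm]] := tail n.+1.
exists n, m; split=> //; have := rnorm_distD z (K (b n)) (K (b m)).
by rewrite (rnorm_distC _ z); lra.
Qed.

(* [b n - b m] and its image have the same norm, but a compact operator brings
   the images of two of the [b n] close to each other. *)
Lemma ess_norm_ge1 T (a b : nat -> H) : bounded_operator T ->
  (forall n, T (b n) = a n) -> (forall n, sq (a n) = 1) -> (forall n, sq (b n) = 1) ->
  (forall i j, i <> j -> dot (a i) (a j) = 0) ->
  (forall i j, i <> j -> dot (b i) (b j) = 0) -> 1 <= ess_norm T.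
Proof.
move=> bT Tb a1 b1 oa ob; apply: ess_norm_ge => K cK; have [bK _] := cK.
have bTK := bounded_operatorB bT bK.
rewrite leNgt; apply/negP; set c := op_norm _ => c1.
have rb n : rnorm (b n) <= 1.
  by have := b1 n; rewrite /sq => h; rewrite -(@expr_le1 _ 2) ?rnorm_ge0 // h.
(* With [r] the common norm of [b n - b m] and [a n - a m], this tolerance gives
   [r < c * r + (1 - c) / 2], that is [r < 1 / 2], whereas [r ^+ 2 = 2]. *)
have c2 : 0 < (1 - c) / 2 by lra.
have [n [m [nm hK]]] := compact_operator_close cK rb c2.
have nm' : n <> m by move=> e; rewrite e ltnn in nm.
have sq2 (w : nat -> H) : (forall n, sq (w n) = 1) ->
    (forall i j, i <> j -> dot (w i) (w j) = 0) -> sq (w n - w m) = 2.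
  move=> w1 ow; have h : dot (w n) (- w m) = 0 by rewrite dotNr ow ?oppr0.
  by rewrite (sqD_orth Hdot h) /sq rnormN -!/(sq _) !w1.
have sb := sq2 b b1 ob; have sa := sq2 a a1 oa.
have se : rnorm (a n - a m) = rnorm (b n - b m).
  by apply/eqP; rewrite eq_le !sq_le // ?sa ?sb.
have := op_norm_mul (b n - b m) bTK; rewrite -/c.
have [Tl _] := bT; have [Kl _] := bK.
rewrite /= (opB Tl) (opB Kl) !Tb.
have := rnorm_distD (K (b n) - K (b m)) (a n - a m) 0; rewrite !subr0 se.
have : 1 <= rnorm (b n - b m).
  rewrite leNgt; apply/negP => h; move: sb; rewrite /sq.
  have := rnorm_ge0 (b n - b m); nra.
move: (rnorm _) (rnorm _) (rnorm _) hK => x y z; nra.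
Qed.

End Compact.

(** * Parametrization of a continuous nest *)

Section NestParam.
Variables (R : realType) (H : completeNormedModType R[i]).
Variable dot : {dot H for Num.conj}.
Hypothesis Hdot : induces_norm dot.
Implicit Types (x y z : H) (E F K M N : H -> H) (NN : set (H -> H)).

Lemma dense_seq_ex : separable H -> exists e : nat -> H,
  forall x (r : R), 0 < r -> exists k, rnorm (x - e k) < r.
Proof.
move=> [D /countable_injP[f fI] dD].
(* [e] inverts the injection of the dense set into [nat]; indices outside of its image get [0]. *)
have /choice[e eP] : forall k, exists y, forall d, D d -> f d = k -> y = d.
  move=> k; have [[d [Dd fd]]|nd] := pselect (exists d, D d /\ f d = k).
    exists d => d' Dd' fd'; apply: (fI d d'); rewrite ?inE //; congruence.
  by exists 0 => d Dd fd; exfalso; apply: nd; exists d.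
exists e => x r r0; have r0' : 0 < r%:C :> R[i] by rewrite ltcR.
have [|d [Bd Dd]] := dD (ball x r%:C)° _ (open_interior _).
  by exists x; apply: nbhsx_ballx.
exists (f d); rewrite (eP _ d) //; have := interior_subset Bd.
by rewrite -ball_normE /= rnormE ltcR.
Qed.

Lemma closure_seq_lim (A : set (H -> H)) (N : nat -> H -> H) T :
  (forall n, A (N n)) -> (forall x, seq_lim (fun n => N n x) (T x)) ->
  closure (A : set {ptws H -> H}) T.
Proof.
move=> AN NT B BT.
have NTp : {ptws, N @ \oo --> T}.
  by apply/pointwise_cvgP => x; apply: seq_lim_cvg; exact: NT.
have [n _ hn] := NTp _ BT.
by exists (N n); split; [exact: AN | apply: hn => /=].
Qed.

Section Weight.
Variable e : nat -> H.
Hypothesis edense : forall x (r : R), 0 < r -> exists k, rnorm (x - e k) < r.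
Variable NN : set (H -> H).
Hypothesis HNN : nest dot NN.

(** The divisor bounds the terms of [psum] by a geometric series whatever the norms of the [e k]. *)
Definition weight k : R := 2^-1 ^+ k / (1 + sq (e k)).

Definition psum m N : R := \sum_(0 <= k < m) weight k * sq (N (e k)).

(* Strictly increasing on the nest, because [e] is dense; a sequence in the nest
   converges strongly as soon as [phi] converges along it. *)
Definition phi N : R := sup (range (psum^~ N)).

Lemma nestP N : NN N -> orth_projection dot N.
Proof. by case: HNN => h _ _ _ _; exact: h. Qed.

Lemma nest_total M N : NN M -> NN N -> op_le dot M N \/ op_le dot N M.
Proof. by case: HNN => _ h _ _ _; exact: h. Qed.

Lemma op_le_trans M N K : op_le dot M N -> op_le dot N K -> op_le dot M K.
Proof. by move=> MN NK x; apply: le_trans (MN x) (NK x). Qed.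

Lemma weight_gt0 k : 0 < weight k.
Proof.
rewrite divr_gt0 ?exprn_gt0 ?invr_gt0 // ltr_pwDl //; exact: sq_ge0.
Qed.

Lemma psum_bound m N : NN N -> psum m N <= 2 - 2 * 2^-1 ^+ m.
Proof.
move=> NNN; elim: m => [|m IH]; first by rewrite /psum big_geq // expr0 mulr1 subrr.
rewrite /psum big_nat_recr //= -/(psum m N).
have : weight m * sq (N (e m)) <= 2^-1 ^+ m.
  rewrite /weight mulrAC -mulrA ler_piMr ?exprn_ge0 ?invr_ge0 //.
  have := sq_ge0 (e m); have : sq (N (e m)) <= sq (e m).
    by rewrite (proj_sq Hdot (e m) (nestP NNN)) lerDl sq_ge0.
  by move=> h1 h2; rewrite ler_pdivrMr; lra.
by rewrite exprS; move: (2^-1 ^+ m) IH => p; lra.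
Qed.

Lemma psum_le2 m N : NN N -> psum m N <= 2.
Proof.
move=> /(psum_bound m); have : 0 <= 2^-1 ^+ m :> R by rewrite exprn_ge0 // invr_ge0.
by move: (_ ^+ m) => p; lra.
Qed.

Lemma phi_has_sup N : NN N -> has_sup (range (psum^~ N)).
Proof.
move=> NNN; split; first by exists (psum 0 N), 0%N.
by exists 2 => _ [m _ <-]; exact: psum_le2.
Qed.

Lemma psum_le_phi m N : NN N -> psum m N <= phi N.
Proof.
by move=> NNN; apply: ub_le_sup; [case: (phi_has_sup NNN) | exists m].
Qed.

Lemma phi_le N (r : R) : (forall m, psum m N <= r) -> phi N <= r.
Proof.
by move=> h; apply: ge_sup; [exists (psum 0 N), 0%N | move=> _ [m _ <-]].
Qed.

Lemma sqB_le M N x : NN M -> NN N -> op_le dot M N ->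
  sq (N x) = sq (M x) + sq (N x - M x).
Proof.
move=> NM NN' MN; have MNx := (op_leP Hdot (nestP NM) (nestP NN')).1 MN.
by rewrite (proj_sq Hdot (N x) (nestP NM)) (MNx x).1.
Qed.

Lemma psumB M N m : NN M -> NN N -> op_le dot M N ->
  psum m N - psum m M = \sum_(0 <= k < m) weight k * sq (N (e k) - M (e k)).
Proof.
move=> NM NN' MN; rewrite /psum -sumrB; apply: eq_bigr => k _.
by rewrite (sqB_le _ NM NN' MN); ring.
Qed.

Lemma psumB_mono M N m m' : NN M -> NN N -> op_le dot M N -> (m <= m')%N ->
  psum m N - psum m M <= psum m' N - psum m' M.
Proof.
move=> NM NN' MN mm; rewrite !psumB // [leRHS](big_cat_nat (leq0n m) mm) /=.
rewrite lerDl; apply: sumr_ge0 => k _; rewrite mulr_ge0 ?sq_ge0 //.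
exact: ltW (weight_gt0 k).
Qed.

Lemma psum_mono N m m' : (m <= m')%N -> psum m N <= psum m' N.
Proof.
move=> mm; rewrite /psum [leRHS](big_cat_nat (leq0n m) mm) /= lerDl.
apply: sumr_ge0 => k _; rewrite mulr_ge0 ?sq_ge0 //.
exact: ltW (weight_gt0 k).
Qed.

Lemma psumB_le_phi M N m : NN M -> NN N -> op_le dot M N ->
  psum m N - psum m M <= phi N - phi M.
Proof.
move=> NM NN' MN; suff : phi M <= phi N - (psum m N - psum m M) by lra.
apply: phi_le => m'.
have := psumB_mono NM NN' MN (leq_maxl m m').
have := psum_mono M (leq_maxr m m').
have := psum_le_phi (maxn m m') NN'; lra.
Qed.

Lemma phi_term M N k : NN M -> NN N -> op_le dot M N ->
  weight k * sq (N (e k) - M (e k)) <= phi N - phi M.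
Proof.
move=> NM NN' MN; apply: le_trans (psumB_le_phi k.+1 NM NN' MN).
rewrite psumB // big_nat_recr //= lerDr; apply: sumr_ge0 => i _.
by rewrite mulr_ge0 ?sq_ge0 // ltW // weight_gt0.
Qed.

Lemma phi_mono M N : NN M -> NN N -> op_le dot M N -> phi M <= phi N.
Proof.
by move=> NM NN' MN; have := psumB_le_phi 0 NM NN' MN; rewrite /psum !big_geq //; lra.
Qed.

(** Every term of the series for [phi N - phi M] is nonnegative, so all vanish and the projections
    agree on a dense sequence. *)
Lemma phi_inj_le M N : NN M -> NN N -> op_le dot M N -> phi N <= phi M -> M = N.
Proof.
move=> NM NN' MN phiNM.
have He k : N (e k) = M (e k).
  apply/eqP; rewrite -subr_eq0; apply/eqP/sq_eq0/eqP.
  rewrite eq_le sq_ge0 andbT -(pmulr_rle0 _ (weight_gt0 k)).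
  by apply: le_trans (phi_term k NM NN' MN) _; lra.
apply/funext => x; apply/eqP; rewrite -subr_eq0; apply/eqP/rnorm_eq0.
apply/eqP; rewrite eq_le rnorm_ge0 andbT; apply/ler_addgt0Pl => r r0.
have r2 : 0 < r / 2 by lra.
have [k hk] := edense x r2.
have -> : M x - N x = M (x - e k) - N (x - e k).
  by rewrite (projB (nestP NM)) (projB (nestP NN')) He opprB addrA subrK.
apply: le_trans (rnormD _ _) _; rewrite rnormN.
have := proj_norm Hdot (x - e k) (nestP NM).
have := proj_norm Hdot (x - e k) (nestP NN'); lra.
Qed.

Lemma phi_lt M N : NN M -> NN N -> op_le dot M N -> M <> N -> phi M < phi N.
Proof.
move=> NM NN' MN ne; rewrite ltNge; apply/negP => h.
by apply: ne; exact: phi_inj_le.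
Qed.

Lemma phi_inj M N : NN M -> NN N -> phi M = phi N -> M = N.
Proof.
move=> NM NN' h; have [MN|NM'] := nest_total NM NN'.
  by apply: phi_inj_le => //; rewrite h.
by apply/esym/phi_inj_le => //; rewrite h.
Qed.

Lemma phi_le_op_le M N : NN M -> NN N -> phi M <= phi N -> op_le dot M N.
Proof.
move=> NM NN' h; have [//|NM'] := nest_total NM NN'.
by rewrite (phi_inj_le NN' NM NM' h).
Qed.

Lemma phi_dist_term M N k : NN M -> NN N ->
  weight k * sq (N (e k) - M (e k)) <= `|phi N - phi M|.
Proof.
move=> NM NN'; have [MN|NM'] := nest_total NM NN'.
  by apply: le_trans (phi_term k NM NN' MN) _; exact: ler_norm.
rewrite distrC; apply: le_trans _ (ler_norm _).
by apply: le_trans (phi_term k NN' NM NM'); rewrite /sq rnorm_distC.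
Qed.

Lemma psum_dist M N m : NN M -> NN N ->
  psum m N - psum m M <= `|phi N - phi M|.
Proof.
move=> NM NN'; have [MN|NM'] := nest_total NM NN'.
  by apply: le_trans (psumB_le_phi m NM NN' MN) _; exact: ler_norm.
apply: le_trans _ (normr_ge0 _).
have := psumB m NN' NM NM'.
have : 0 <= \sum_(0 <= k < m) weight k * sq (M (e k) - N (e k)).
  by apply: sumr_ge0 => k _; rewrite mulr_ge0 ?sq_ge0 // ltW // weight_gt0.
lra.
Qed.

(** Convergence of [phi] makes the sequence Cauchy at each [e k], hence at every vector by density
    and contractivity; strong closedness puts the limit into the nest. *)
Lemma nest_complete (N : nat -> H -> H) (r : R) : (forall n, NN (N n)) ->
  (forall d : R, 0 < d -> exists n0, forall n, (n0 <= n)%N -> `|phi (N n) - r| < d) ->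
  exists2 M, NN M & phi M = r.
Proof.
move=> NNn hr.
have cau (d : R) : 0 < d -> exists n0, forall n m, (n0 <= n)%N -> (n0 <= m)%N ->
    `|phi (N n) - phi (N m)| < d.
  move=> d0; have d2 : 0 < d / 2 by lra.
  have [n0 h] := hr _ d2; exists n0 => n m /h hn /h hm.
  by have := ler_distD r (phi (N n)) (phi (N m)); rewrite (distrC r); lra.
have /choice[M NM] : forall x, exists y, seq_lim (fun n => N n x) y.
  move=> x; apply: seq_lim_ex => d d0; have d3 : 0 < d / 3 by lra.
  have [k hk] := edense x d3.
  have h0 : 0 < weight k * (d / 3) ^+ 2 by rewrite mulr_gt0 ?weight_gt0 ?exprn_gt0.
  have [n0 hn0] := cau _ h0; exists n0 => n nn0.
  have : rnorm (N n (e k) - N n0 (e k)) < d / 3.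
    apply: sq_lt => //; rewrite -(ltr_pM2l (weight_gt0 k)).
    by apply: le_lt_trans (phi_dist_term k (NNn _) (NNn _)) (hn0 _ _ _ _).
  have -> : N n x - N n0 x =
      (N n (x - e k) - N n0 (x - e k)) + (N n (e k) - N n0 (e k)).
    have [[Nl _] _ _] := nestP (NNn n); have [[N0l _] _ _] := nestP (NNn n0).
    by rewrite -{1 2}(subrK (e k) x) (opD Nl (x - e k)) (opD N0l (x - e k)) opprD addrACA.
  have := rnormD (N n (x - e k) - N n0 (x - e k)) (N n (e k) - N n0 (e k)).
  have := rnormD (N n (x - e k)) (- N n0 (x - e k)); rewrite rnormN.
  have := proj_norm Hdot (x - e k) (nestP (NNn n)).
  have := proj_norm Hdot (x - e k) (nestP (NNn n0)); lra.
have bM : bounded_operator M.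
  apply: (@bounded_operator_intro _ _ _ 1) => [c x y|x]; last first.
    rewrite mul1r; apply: (seq_lim_norm_le (NM x)) => n.
    by apply: (proj_norm Hdot); exact: nestP (NNn n).
  apply: (seq_lim_uniq (NM _)).
  have := seq_limD (seq_lim_bounded (bounded_operatorZ H c) (NM x)) (NM y).
  congr seq_lim; apply/funext => n; have [[Nl _] _ _] := nestP (NNn n).
  by rewrite Nl.
have NNM : NN M.
  by case: HNN => _ _ _ _ /(_ M bM); apply; exact: closure_seq_lim NM.
exists M => //.
have psum_lim m (d : R) : 0 < d -> exists n0, forall n, (n0 <= n)%N ->
    `|psum m (N n) - psum m M| < d.
  move=> d0; suff : psum m (N n) @[n --> \oo] --> psum m M.
    by move=> /cvgrPdist_lt /(_ _ d0)[n0 _ h]; exists n0 => n /h /=; rewrite distrC.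
  elim: m => [|k IH].
    have E N' : psum 0 N' = 0 by rewrite /psum big_geq.
    by rewrite E; under eq_fun do rewrite E; exact: cvg_cst.
  have E N' : psum k.+1 N' = psum k N' + weight k * sq (N' (e k)).
    by rewrite /psum big_nat_recr.
  rewrite E; under eq_fun do rewrite E; apply: cvgD => //; apply: cvgMr.
  have cr : rnorm (N n (e k)) @[n --> \oo] --> rnorm (M (e k)).
    apply/cvgrPdist_lt => d' d'0; have [n0 h] := NM (e k) _ d'0.
    exists n0 => // n /= /h; apply: le_lt_trans; rewrite ler_norml.
    have := rnorm_distD (N n (e k)) (M (e k)) 0.
    have := rnorm_distD (M (e k)) (N n (e k)) 0.
    by rewrite !subr0 (rnorm_distC (M _)) => *; apply/andP; split; lra.
  by rewrite /sq; under eq_fun do rewrite expr2; rewrite expr2; apply: cvgM.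
apply/eqP; rewrite eq_le; apply/andP; split; apply/ler_addgt0Pl => d d0.
  apply: phi_le => m; have d2 : 0 < d / 2 by lra.
  have [n0 h0] := psum_lim m _ d2; have [n1 h1] := hr _ d2.
  have := h0 _ (leq_maxl n0 n1); have := h1 _ (leq_maxr n0 n1).
  have := psum_le_phi m (NNn (maxn n0 n1)).
  by rewrite !ltr_norml => ? /andP[? ?] /andP[? ?]; lra.
(* To bound [phi (N n)], each [psum m (N n)] is compared with [psum m] at a later index that may
   depend on [m]; the error from [psum_dist] does not. *)
have d4 : 0 < d / 4 by lra.
have [n0 h0] := hr _ d4; have [n1 h1] := cau _ d4.
pose n := maxn n0 n1.
have : phi (N n) <= phi M + d / 2.
  apply: phi_le => m; have [n2 h2] := psum_lim m _ d4.
  have := h2 _ (leq_maxl n2 n1); rewrite ltr_norml => /andP[_].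
  have := psum_dist m (NNn (maxn n2 n1)) (NNn n).
  have := h1 _ _ (leq_maxr n0 n1 : (n1 <= n)%N) (leq_maxr n2 n1).
  have := psum_le_phi m NNM; lra.
by have := h0 n (leq_maxl _ _); rewrite ltr_norml => /andP[? ?]; lra.
Qed.

(** If an end stuck out, the smaller interval would have a nonzero subinterval [K \- N1] or
    [N2 \- K] orthogonal to the larger one. *)
Lemma op_le_endpoints M M' N1 N2 : NN M -> NN M' -> NN N1 -> NN N2 ->
  op_le dot M M' -> op_le dot N1 N2 -> N1 <> N2 ->
  op_le dot (N2 \- N1) (M' \- M) -> op_le dot M N1 /\ op_le dot N2 M'.
Proof.
move=> NM NM' NN1 NN2 MM N12 ne F.
have P N K : NN N -> NN K -> op_le dot N K -> forall x, N (K x) = N x /\ K (N x) = N x.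
  by move=> NN' NK; apply: (op_leP Hdot (nestP NN') (nestP NK)).1.
have pI N K : NN N -> NN K -> op_le dot N K -> orth_projection dot (K \- N).
  by move=> NN' NK; apply: op_leB => //; exact: nestP.
have key x : (N2 \- N1) x = x -> (M' \- M) x = 0 -> x = 0.
  move=> h1 h2; apply: sq_eq0; apply/eqP; rewrite eq_le sq_ge0 andbT.
  have := op_le_sq Hdot x (pI _ _ NN1 NN2 N12) (pI _ _ NM NM' MM) F.
  by rewrite h1 h2 sq0.
have neE K K' : K <> K' -> exists z, K z - K' z <> 0.
  move=> hne; apply: contrapT => /forallNP h; apply: hne; apply/funext => z.
  by apply/eqP; rewrite -subr_eq0; apply/eqP; exact: contrapT (h z).
have pB N (NN' : NN N) := projB (nestP NN').
have idem N z (NN' : NN N) := proj_idem z (nestP NN').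
split; apply: contrapT => nle.
- have N1M : op_le dot N1 M by have [] := nest_total NM NN1.
  have neM : N1 <> M by move=> h; apply: nle; rewrite h.
  (* The smaller of [M] and [N2]. *)
  have [K [NK K1 K2 KM neK]] : exists K, [/\ NN K, op_le dot N1 K, op_le dot K N2,
      op_le dot K M & K <> N1].
    have [h|h] := nest_total NM NN2.
      by exists M; split=> //; exact: nesym.
    by exists N2; split=> //; exact: nesym.
  have [z hz] := neE _ _ neK; apply: hz; apply: key => /=.
    rewrite (pB _ NN2) (pB _ NN1) (P _ _ NK NN2 K2 z).2 (P _ _ NN1 NN2 N12 z).2.
    by rewrite (P _ _ NN1 NK K1 z).1 idem ?subrr ?subr0.
  have KM' := op_le_trans KM MM; have N1M' := op_le_trans N1M MM.
  rewrite (pB _ NM') (pB _ NM) (P _ _ NK NM KM z).2 (P _ _ NN1 NM N1M z).2.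
  by rewrite (P _ _ NK NM' KM' z).2 (P _ _ NN1 NM' N1M' z).2 subrr.
- have M'N : op_le dot M' N2 by have [] := nest_total NM' NN2.
  have neM : N2 <> M' by move=> h; apply: nle; rewrite h.
  (* The larger of [M'] and [N1]. *)
  have [K [NK K1 K2 KM neK]] : exists K, [/\ NN K, op_le dot N1 K, op_le dot K N2,
      op_le dot M' K & N2 <> K].
    have [h|h] := nest_total NM' NN1.
      by exists N1; split=> //; exact: nesym.
    by exists M'; split.
  have [z hz] := neE _ _ neK; apply: hz; apply: key => /=.
    rewrite (pB _ NN2) (pB _ NN1) (P _ _ NK NN2 K2 z).2 (P _ _ NN1 NN2 N12 z).1.
    by rewrite (P _ _ NN1 NK K1 z).1 idem ?subrr ?subr0.
  have MK := op_le_trans MM KM; have MN2 := op_le_trans MM M'N.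
  rewrite (pB _ NM') (pB _ NM) (P _ _ NM' NN2 M'N z).1 (P _ _ NM' NK KM z).1.
  by rewrite (P _ _ NM NN2 MN2 z).1 (P _ _ NM NK MK z).1 !subrr.
Qed.

(** By completeness the supremum of the values up to [r] and the infimum of those from [r] on are
    attained. If [r] were missed, the interval between the two would be an atom. *)
Lemma phi_onto (r : R) : (forall E, ~ atom dot NN E) -> 0 <= r -> r <= phi idfun ->
  exists2 N, NN N & phi N = r.
Proof.
move=> natom r0 r1; have [_ _ nz no _] := HNN.
have phi0 : phi \0 = 0.
  apply/eqP; rewrite eq_le; apply/andP; split.
    by apply: phi_le => m; rewrite /psum big1 // => k _ /=; rewrite sq0 mulr0.
  by have := psum_le_phi 0 nz; rewrite /psum big_geq.
have approx (P : set (H -> H)) (al : R) : P `<=` NN ->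
    (forall d : R, 0 < d -> exists2 N, P N & `|phi N - al| < d) ->
    exists2 M, NN M & phi M = al.
  move=> PN h; have /choice[N NP] : forall n : nat, exists N, P N /\
      `|phi N - al| < n.+1%:R^-1.
    by move=> n; have [|N PN' hN] := h n.+1%:R^-1; [rewrite invr_gt0 | exists N].
  apply: (@nest_complete N) => [n|d d0]; first by apply: PN; case: (NP n).
  have [k hk] := harmonic_small d0 1; exists k => n kn.
  have [_ hn] := NP n; apply: lt_trans hn _; apply: le_lt_trans hk.
  by rewrite div1r lef_pV2 ?posrE ?ltr0n // ler_nat.
pose A := [set N | NN N /\ phi N <= r].
pose B := [set N | NN N /\ r <= phi N].
have hA : has_sup (phi @` A).
  by split; [exists (phi \0), \0 => //; split=> //; rewrite phi0 |
    exists r => _ [N [_ h] <-]].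
have hB : has_inf (phi @` B).
  by split; [exists (phi idfun), idfun | exists r => _ [N [_ h] <-]].
have Ar : sup (phi @` A) <= r by apply: ge_sup; [case: hA | move=> _ [N [_ h] <-]].
have Br : r <= inf (phi @` B) by apply: lb_le_inf; [case: hB | move=> _ [N [_ h] <-]].
have Aub N : A N -> phi N <= sup (phi @` A).
  by move=> AN; apply: ub_le_sup; [case: hA | exists N].
have Blb N : B N -> inf (phi @` B) <= phi N.
  by move=> BN; apply: ge_inf; [case: hB | exists N].
have [M NM phiM] : exists2 M, NN M & phi M = sup (phi @` A).
  apply: (approx A) => [N []//|d d0].
  have [_ [N AN <-] hN] := sup_adherent d0 hA; exists N => //.
  by have := Aub _ AN; rewrite ltr_norml => ?; apply/andP; split; lra.
have [M' NM' phiM'] : exists2 M, NN M & phi M = inf (phi @` B).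
  apply: (approx B) => [N []//|d d0].
  have [_ [N BN <-] hN] := inf_adherent d0 hB; exists N => //.
  by have := Blb _ BN; rewrite ltr_norml => ?; apply/andP; split; lra.
have [Ar'|rA] := ltP (sup (phi @` A)) r; last by exists M => //; lra.
have [Br'|rB] := ltP r (inf (phi @` B)); last by exists M' => //; lra.
have MM : op_le dot M M' by apply: phi_le_op_le => //; lra.
have neM : M <> M' by move=> h; move: phiM; rewrite h phiM'; lra.
exfalso; apply: (natom (M' \- M)); split.
- by exists M, M'.
- move=> h; apply: neM; apply/funext => x; apply/esym/eqP; rewrite -subr_eq0.
  by rewrite -[_ - _]/((M' \- M) x) h.
- move=> F [N1 [N2 [NN1 NN2 N12 ->]]] hF.
  have [->|ne12] := pselect (N1 = N2).
    by left; apply/funext => x /=; rewrite subrr.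
  have [MN1 N2M] := op_le_endpoints NM NM' NN1 NN2 MM N12 ne12 hF.
  have two N : NN N -> op_le dot M N -> op_le dot N M' -> N = M \/ N = M'.
    move=> NN' MN NM''; have [h|h] := leP (phi N) r.
      left; apply/esym/phi_inj_le => //; rewrite phiM; exact: Aub.
    by right; apply: phi_inj_le => //; rewrite phiM'; apply: Blb; split=> //; exact: ltW.
  have N1M := op_le_trans N12 N2M; have MN2 := op_le_trans MN1 N12.
  have [e1|e1] := two _ NN1 MN1 N1M; have [e2|e2] := two _ NN2 MN2 N2M.
  + by exfalso; apply: ne12; rewrite e1.
  + by right; rewrite e1 e2.
  + exfalso; apply: neM; apply: phi_inj => //; rewrite phiM phiM'.
    by have := phi_mono NN1 NN2 N12; rewrite e1 e2 phiM phiM'; lra.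
  + by exfalso; apply: ne12; rewrite e1.
Qed.

End Weight.

(** An order isomorphism of [[0, 1]] onto the nest; values outside of [[0, 1]] are unconstrained. *)
Definition nest_param NN (nu : R -> H -> H) := [/\ nu 0 = \0, nu 1 = idfun,
  forall t, 0 <= t -> t <= 1 -> NN (nu t),
  forall s t, 0 <= s -> t <= 1 -> s <= t -> op_le dot (nu s) (nu t) &
  (forall s t, 0 <= s -> t <= 1 -> s < t -> nu s <> nu t) /\
  forall N, NN N -> exists t, [/\ 0 <= t, t <= 1 & nu t = N]].

(** [nu t] is the element at which [phi] equals [t * phi idfun]; a nonzero vector makes the factor
    positive. *)
Lemma nest_param_ex NN : separable H -> continuous_nest dot NN ->
  (exists x : H, x <> 0) -> exists nu, nest_param NN nu.
Proof.
move=> Hsep [HNN natom] [x0 x0n]; have [e edense] := dense_seq_ex Hsep.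
have [_ _ N0 N1 _] := HNN; pose c := phi e idfun.
have phi0 : phi e \0 = 0.
  apply/eqP; rewrite eq_le; apply/andP; split.
    by apply: phi_le => m; rewrite /psum big1 // => k _ /=; rewrite sq0 mulr0.
  by have := psum_le_phi e HNN 0 N0; rewrite /psum big_geq.
have op0N N : NN N -> op_le dot \0 N.
  move=> NN'; have h := nestP HNN NN'.
  by move=> x; rewrite (proj_dot Hdot x h) dot0l lecR sq_ge0.
have opN1 N : NN N -> op_le dot N idfun.
  move=> NN'; have [h|h] := nest_total HNN NN' N1 => //.
  move=> x; rewrite (proj_dot Hdot x (nestP HNN NN')) (sqE Hdot) lecR.
  by rewrite (proj_sq Hdot x (nestP HNN NN')) lerDl sq_ge0.
have c0 : 0 < c.
  rewrite /c -phi0; apply: (phi_lt edense HNN N0 N1 (op0N _ N1)).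
  by move=> h; apply: x0n; rewrite -[x0]/(idfun x0) -h.
have /choice[nu nuP] : forall t : R, exists N, 0 <= t -> t <= 1 ->
    NN N /\ phi e N = t * c.
  move=> t; have [/andP[t0 t1]|nt] := boolP (0 <= t <= 1); last first.
    by exists \0 => t0 t1; move: nt; rewrite t0 t1.
  have [||N NN' hN] := phi_onto edense HNN (r := t * c) natom.
  - by rewrite mulr_ge0 // ltW.
  - by rewrite -/c ler_piMl // ltW.
  by exists N.
exists nu; split.
- have [NN' h] := nuP 0 (lexx _) ler01.
  by apply: (phi_inj edense HNN) => //; rewrite h phi0 mul0r.
- have [NN' h] := nuP 1 ler01 (lexx _).
  by apply: (phi_inj edense HNN) => //; rewrite h mul1r.
- by move=> t t0 t1; have [] := nuP t t0 t1.
- move=> s t s0 t1 st; have [Ns hs] := nuP s s0 (le_trans st t1).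
  have [Nt ht] := nuP t (le_trans s0 st) t1.
  by apply: (phi_le_op_le edense HNN) => //; rewrite hs ht ler_pM2r.
split=> [s t s0 t1 st|N NN'].
  have [Ns hs] := nuP s s0 (le_trans (ltW st) t1).
  have [Nt ht] := nuP t (le_trans s0 (ltW st)) t1.
  by move=> h; move: hs; rewrite h ht => /(mulIf (lt0r_neq0 c0)); lra.
have p0 : 0 <= phi e N by rewrite -phi0; exact: (phi_mono e HNN N0 NN' (op0N _ NN')).
have p1 : phi e N <= c by exact: (phi_mono e HNN NN' N1 (opN1 _ NN')).
exists (phi e N / c); have q0 : 0 <= phi e N / c by rewrite divr_ge0 // ltW.
have q1 : phi e N / c <= 1 by rewrite ler_pdivrMr // mul1r.
split=> //; have [Nq hq] := nuP _ q0 q1.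
by apply: (phi_inj edense HNN) => //; rewrite hq divfK // gt_eqF.
Qed.

End NestParam.

(** * The separating operator *)

Section IntervalVectors.
Variables (R : realType) (H : completeNormedModType R[i]).
Variable dot : {dot H for Num.conj}.
Hypothesis Hdot : induces_norm dot.
Variable NN : set (H -> H).
Hypothesis HNN : nest dot NN.
Variable nu : R -> H -> H.
Hypothesis Hnu : nest_param dot NN nu.
Implicit Types (x y z v : H) (s t p q : R).

Lemma nu_proj t : 0 <= t -> t <= 1 -> orth_projection dot (nu t).
Proof. by case: Hnu => _ _ h _ _ t0 t1; apply: (nestP HNN); exact: h. Qed.

Lemma nu_le s t : 0 <= s -> t <= 1 -> s <= t -> op_le dot (nu s) (nu t).
Proof. by case: Hnu => _ _ _ h _; exact: h. Qed.

Lemma nu_le_inv s t : 0 <= s -> s <= 1 -> 0 <= t -> t <= 1 ->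
  op_le dot (nu s) (nu t) -> s <= t.
Proof.
move=> s0 s1 t0 t1 st; rewrite leNgt; apply/negP => ts.
case: Hnu => _ _ _ _ [/(_ t s t0 s1 ts) ne _]; apply: ne.
by apply: (op_le_antisym Hdot (nu_proj t0 t1) (nu_proj s0 s1)) => //;
  apply: nu_le => //; exact: ltW.
Qed.

Lemma nu_comp s t x : 0 <= s -> t <= 1 -> s <= t ->
  nu s (nu t x) = nu s x /\ nu t (nu s x) = nu s x.
Proof.
move=> s0 t1 st; have ps := nu_proj s0 (le_trans st t1).
have pt := nu_proj (le_trans s0 st) t1.
exact: (op_leP Hdot ps pt).1 (nu_le s0 t1 st) x.
Qed.

(** For [s <= t] in [[0, 1]], the range of the interval projection [nu t \- nu s]. *)
Definition supported s t v := nu t v = v /\ nu s v = 0.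

Lemma supported_up s t r v : 0 <= s -> s <= t -> t <= r -> r <= 1 ->
  supported s t v -> nu r v = v.
Proof.
move=> s0 st tr r1 [tv sv]; rewrite -[in LHS]tv.
by rewrite (nu_comp v (le_trans s0 st) r1 tr).2.
Qed.

Lemma supported_down s t r v : 0 <= r -> r <= s -> s <= 1 ->
  supported s t v -> nu r v = 0.
Proof.
move=> r0 rs s1 [tv sv]; rewrite -(nu_comp v r0 s1 rs).1 sv.
by have [[Nl _] _ _] := nu_proj r0 (le_trans rs s1); rewrite (op0 Nl).
Qed.

Lemma supportedW s t s' t' v : 0 <= s' -> s' <= s -> s <= t -> t <= t' -> t' <= 1 ->
  supported s t v -> supported s' t' v.
Proof.
move=> s0 ss st tt t1 sv; split.
  by apply: (supported_up (le_trans s0 ss) st tt t1 sv).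
by apply: (supported_down s0 ss _ sv); lra.
Qed.

Lemma supported_lin s t (a b : R[i]) v w : 0 <= s -> s <= t -> t <= 1 ->
  supported s t v -> supported s t w -> supported s t (a *: v + b *: w).
Proof.
move=> s0 st t1 [tv sv] [tw sw].
have [[tl _] _ _] := nu_proj (le_trans s0 st) t1.
have [[sl _] _ _] := nu_proj s0 (le_trans st t1).
by split; rewrite ?tl ?sl ?(opZ tl) ?(opZ sl) ?tv ?tw ?sv ?sw // !scaler0 addr0.
Qed.

Lemma supported_orth s t r v w : 0 <= s -> s <= t -> t <= r -> r <= 1 ->
  supported s t v -> nu t w = 0 -> dot v w = 0.
Proof.
move=> s0 st tr r1 [tv _] w0; have t1 : t <= 1 by lra.
have [_ _ sa] := nu_proj (le_trans s0 st) t1.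
by rewrite -tv sa w0 dot0r.
Qed.

Lemma supported_ex s t : 0 <= s -> t <= 1 -> s < t ->
  exists v, supported s t v /\ v <> 0.
Proof.
move=> s0 t1 st; have ps := nu_proj s0 (le_trans (ltW st) t1).
have pt := nu_proj (le_trans s0 (ltW st)) t1.
have [x hx] : exists x, nu t x - nu s x <> 0.
  apply: contrapT => /forallNP h; case: Hnu => _ _ _ _ [/(_ s t s0 t1 st) ne _].
  apply: ne; apply/funext => x; apply/esym/eqP; rewrite -subr_eq0; apply/eqP.
  exact: contrapT (h x).
exists (nu t x - nu s x); split=> //; split.
  rewrite (projB pt) (proj_idem _ pt).
  by rewrite (nu_comp x s0 t1 (ltW st)).2.
rewrite (projB ps) (proj_idem _ ps).
by rewrite (nu_comp x s0 t1 (ltW st)).1 subrr.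
Qed.

(* Of two orthogonal vectors, supported over the two halves of the interval,
   some combination is also orthogonal to [l]. *)
Lemma supported_orth_ex (L : seq H) s t : 0 <= s -> t <= 1 -> s < t ->
  exists v, [/\ supported s t v, v <> 0 & forall l, l \in L -> dot v l = 0].
Proof.
elim: L s t => [|l L IH] s t s0 t1 st.
  by have [v [sv v0]] := supported_ex s0 t1 st; exists v.
pose r := (s + t) / 2; have sr : s < r by rewrite /r; lra.
have rt : r < t by rewrite /r; lra.
have r0 : 0 <= r by lra.
have r1 : r <= 1 by lra.
have [v [sv v0 vL]] := IH s r s0 r1 sr; have [w [sw w0 wL]] := IH r t r0 t1 rt.
have sv' := supportedW s0 (lexx s) (ltW sr) (ltW rt) t1 sv.
have sw' := supportedW s0 (ltW sr) (ltW rt) (lexx t) t1 sw.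
have [vl|vl] := eqVneq (dot v l) 0.
  by exists v; split=> // l'; rewrite inE => /predU1P[->|/vL].
pose u := dot w l *: v + (- dot v l) *: w.
exists u; split.
- exact: supported_lin s0 (ltW st) t1 sv' sw'.
- move=> u0; have vw : dot w v = 0.
    by rewrite (dotC dot) (supported_orth s0 (ltW sr) (lexx r) r1 sv sw.2) rmorph0.
  have : dot u w = 0 by rewrite u0 dot0l.
  rewrite dotDl !dotZl (dotC dot v w) vw rmorph0 mulr0 add0r (sqE Hdot) => /eqP.
  rewrite mulf_eq0 oppr_eq0 (negbTE vl) /= => /eqP h; apply: w0.
  by apply: sq_eq0; exact: complexI h.
- move=> l'; rewrite inE => /predU1P[->|l'L].
    by rewrite dotDl !dotZl mulNr mulrC subrr.
  by rewrite dotDl !dotZl (vL _ l'L) (wL _ l'L) !mulr0 addr0.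
Qed.

(** The intervals may overlap, so orthogonality is arranged recursively: each vector is chosen
    orthogonal to the list [g n] of its predecessors. *)
Lemma orthonormal_seq_ex (p q : nat -> R) :
  (forall n, 0 <= p n) -> (forall n, p n < q n) -> (forall n, q n <= 1) ->
  exists z : nat -> H, [/\ forall n, supported (p n) (q n) (z n),
    forall n, sq (z n) = 1 & forall i j, i <> j -> dot (z i) (z j) = 0].
Proof.
move=> p0 pq q1.
have /choice[sel selP] : forall Ln : (seq H * nat)%type, exists v,
    [/\ supported (p Ln.2) (q Ln.2) v, sq v = 1 &
        forall l, l \in Ln.1 -> dot v l = 0].
  move=> [L n] /=; have [v [sv v0 vL]] := supported_orth_ex L (p0 n) (q1 n) (pq n).
  have nv : 0 < rnorm v.
    by rewrite lt_neqAle rnorm_ge0 andbT eq_sym; apply/eqP => /rnorm_eq0.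
  pose k : R[i] := (rnorm v)^-1%:C; exists (k *: v); split.
  - have := supported_lin k 0 (p0 n) (ltW (pq n)) (q1 n) sv sv.
    by rewrite scale0r addr0.
  - rewrite sqZ /csq /k ger0_norm ?lecR ?invr_ge0 ?rnorm_ge0 //= -exprMn mulVf ?expr1n //.
    exact: lt0r_neq0.
  - by move=> l lL; rewrite dotZl vL // mulr0.
pose g := fix g n := if n is m.+1 then sel (g m, m) :: g m else [::].
pose z n := sel (g n, n).
have zg m n : (m < n)%N -> z m \in g n.
  elim: n => // n IH; rewrite ltnS leq_eqVlt inE => /predU1P[->|/IH ->].
    by rewrite eqxx.
  by rewrite orbT.
have orth i j : (j < i)%N -> dot (z i) (z j) = 0.
  by move=> /zg ji; have [_ _ /(_ _ ji)] := selP (g i, i).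
exists z; split=> [n|n|i j ij].
- by have [] := selP (g n, n).
- by have [] := selP (g n, n).
- have [h|h|//] := ltngtP i j; last exact: orth.
  by rewrite (dotC dot) orth // rmorph0.
Qed.

Lemma finite_nat_bound (A : set nat) : finite_set A ->
  exists N, forall i, A i -> (i < N)%N.
Proof.
move=> /finite_seqP[r ->]; exists (\max_(i <- r) i).+1 => i /= ir.
by rewrite ltnS; exact: leq_bigmax_seq.
Qed.

(** [X] is the sum of the rank one operators [dot x (b n) *: a n] over an enumeration of [T].
    Finitely many touching quadruples leave a finite sum; infinitely many inside ones leave an
    orthonormal sequence mapped to another, to which [ess_norm_ge1] applies. *)
Lemma separating_operator (T : set (quad R)) : countable T ->
  T `<=` @quad_valid R -> exists X, [/\ Alg NN X,
    forall a b, 0 <= a -> a <= b -> b <= 1 -> finite_set (T `&` touching a b) ->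
      compact_operator ((nu b \- nu a) \o X \o (nu b \- nu a)) &
    forall s t, 0 <= s -> s <= t -> t <= 1 -> infinite_set (T `&` inside s t) ->
      1 <= ess_norm ((nu t \- nu s) \o X \o (nu t \- nu s))].
Proof.
move=> /countable_injP[f fI] Tv.
pose D n := exists c, T c /\ f c = n.
have /choice[qd qdP] : forall n, exists c, quad_valid c /\ (D n -> T c /\ f c = n).
  move=> n; have [[c [Tc fc]]|nD] := pselect (D n).
    by exists c; split=> //; exact: Tv.
  (* Any valid quadruple would do at an index that codes no element of [T], since [a] vanishes
     there. *)
  by exists ((0, 3^-1), (2^-1, 1)); split=> //; split=> /=; lra.
have qdf c : T c -> qd (f c) = c.
  move=> Tc; have [_ []] := qdP (f c); first by exists c.
  by move=> Tq fq; apply: fI; rewrite ?inE.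
(* A single orthonormal sequence provides the [a] at even and the [b] at odd indices. *)
pose p n := if odd n then (qd n./2).2.1 else (qd n./2).1.1.
pose q n := if odd n then (qd n./2).2.2 else (qd n./2).1.2.
have [z [zs z1 zo]] : exists z : nat -> H, [/\ forall n, supported (p n) (q n) (z n),
    forall n, sq (z n) = 1 & forall i j, i <> j -> dot (z i) (z j) = 0].
  by apply: orthonormal_seq_ex => n; have [[? ? ? ? ?] _] := qdP n./2;
    rewrite /p /q; case: ifP; lra.
pose a n := if `[< D n >] then z n.*2 else 0.
pose b n := z n.*2.+1.
have zS n : supported (qd n).1.1 (qd n).1.2 (z n.*2).
  by have := zs n.*2; rewrite /p /q odd_double doubleK.
have bS n : supported (qd n).2.1 (qd n).2.2 (b n).
  by have := zs n.*2.+1; rewrite /p /q /= odd_double /= uphalf_double.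
have oa i j : i <> j -> dot (a i) (a j) = 0.
  move=> ij; rewrite /a; case: ifP; case: ifP; rewrite ?dot0l ?dot0r // => _ _.
  by apply: zo => /double_inj.
have ob i j : i <> j -> dot (b i) (b j) = 0.
  by move=> ij; apply: zo => -[/double_inj].
have a1 i : sq (a i) <= 1 by rewrite /a; case: ifP => _; rewrite ?z1 ?sq0.
have b1 i : sq (b i) <= 1 by rewrite z1.
have [X [bX _ Xlim]] := series_operator Hdot oa a1 ob b1.
exists X; split.
- split=> // N NNN; have [r [r0 r1 <-]] : exists t, [/\ 0 <= t, t <= 1 & nu t = N].
    by case: Hnu => _ _ _ _ [_]; apply.
  have pr := nu_proj r0 r1; have [[rl _] _ sa] := pr.
  apply/funext => x /=; apply: (seq_lim_uniq (Xlim _)).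
  have := seq_lim_bounded (proj_bounded pr) (Xlim (nu r x)).
  congr seq_lim; apply/funext => n; rewrite (op_sum rl); apply: eq_bigr => i _.
  rewrite (opZ rl) sa; have [[x0 xx xy yy y1] _] := qdP i.
  (* Either [nu r] kills [b i], or [r] lies beyond the left interval and [nu r] fixes [a i]; in both
     cases the term satisfies the nest algebra identity. *)
  have [ry|yr] := leP r (qd i).2.1.
    by rewrite (supported_down r0 ry _ (bS i)) ?dot0r ?scale0r //; lra.
  rewrite /a; case: ifP => _; last by rewrite (op0 rl).
  by rewrite (supported_up x0 (ltW xx) _ r1 (zS i)) //; lra.
- move=> s t s0 st t1 /(finite_image f) /finite_nat_bound[N HN].
  have ps := nu_proj s0 (le_trans st t1); have pt := nu_proj (le_trans s0 st) t1.
  have pF := op_leB Hdot ps pt (nu_le s0 t1 st).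
  have [bF _ sF] := pF; have [Fl _] := bF.
  set F := nu t \- nu s in pF bF sF Fl *.
  have term0 i x : (N <= i)%N -> dot x (F (b i)) *: F (a i) = 0.
    move=> Ni; rewrite /a; case: asboolP => [Di|_]; last by rewrite (op0 Fl) scaler0.
    have [[x0 xx xy yy y1] /(_ Di)[Tq fq]] := qdP i.
    have ntouch : ~ touching s t (qd i).
      move=> tq; have : (i < N)%N by apply: HN; exists (qd i).
      by rewrite ltnNge Ni.
    have [xs|sx] := leP (qd i).1.2 s.
      have -> : F (z i.*2) = 0; last by rewrite scaler0.
      rewrite /F /= (supported_up x0 (ltW xx) xs _ (zS i)); last lra.
      by rewrite (supported_up x0 (ltW xx) _ _ (zS i)) ?subrr //; lra.
    have ty : t <= (qd i).2.1 by rewrite leNgt; apply/negP => h; apply: ntouch.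
    have -> : F (b i) = 0; last by rewrite dot0r scale0r.
    rewrite /F /= (supported_down _ ty _ (bS i)); [|lra|lra].
    by rewrite (supported_down s0 _ _ (bS i)) ?subrr //; lra.
  rewrite (_ : F \o X \o F = (fun x => \sum_(0 <= i < N) dot x (F (b i)) *: F (a i))).
    apply: compact_operator_sum => i; apply: (compact_rank_one Hdot).
    by apply: le_trans (b1 i); rewrite (proj_sq Hdot (b i) pF) lerDl sq_ge0.
  apply/funext => x /=; have := seq_lim_bounded bF (Xlim (F x)).
  move=> /(@seq_lim_const_tail _ _ _ _ N) -> => [|n Nn].
    by rewrite (op_sum Fl); apply: eq_bigr => i _; rewrite (opZ Fl) sF.
  rewrite !(op_sum Fl) (big_cat_nat (leq0n N) Nn) /= [X in _ + X]big_seq.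
  rewrite [X in _ + X]big1 ?addr0 // => i; rewrite mem_index_iota => /andP[Ni _].
  by rewrite (opZ Fl) sF term0.
move=> s t s0 st t1 /infiniteP/pcard_leP[g].
have gT k : T (g k) /\ inside s t (g k) by have := @funS _ _ _ _ g k I.
have gI : injective g by move=> k l kl; apply: (@inj _ _ _ g) => //; rewrite inE.
have fgI : injective (f \o g).
  move=> k l /= kl; apply: gI; apply: fI => //; rewrite inE; by case: (gT k); case: (gT l).
have ps := nu_proj s0 (le_trans st t1); have pt := nu_proj (le_trans s0 st) t1.
have pF := op_leB Hdot ps pt (nu_le s0 t1 st).
have Fid v : supported s t v -> (nu t \- nu s) v = v.
  by move=> [tv sv]; rewrite /= tv sv subr0.
have Dg k : `[< D (f (g k)) >].
  by apply/asboolP; exists (g k); split=> //; case: (gT k).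
have qg k : qd (f (g k)) = g k by apply: qdf; case: (gT k).
apply: (@ess_norm_ge1 _ _ _ Hdot _ (fun k => a (f (g k))) (fun k => b (f (g k)))).
- by have [bF _ _] := pF; exact: (bounded_operator_comp (bounded_operator_comp bF bX) bF).
- move=> k; have [Tk [sk kt]] := gT k; have [x0 xx xy yy y1] := Tv _ Tk.
  have Fb : supported s t (b (f (g k))).
    by apply: supportedW (bS _); rewrite ?qg //; clear -sk kt x0 xx xy yy y1; lra.
  have Fa : supported s t (a (f (g k))).
    rewrite /a Dg; apply: supportedW (zS _); rewrite ?qg //;
      clear -sk kt x0 xx xy yy y1; lra.
  have -> : ((nu t \- nu s) \o X \o (nu t \- nu s)) (b (f (g k))) =
      (nu t \- nu s) (X ((nu t \- nu s) (b (f (g k))))) by [].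
  rewrite (Fid _ Fb); set j := f (g k).
  have -> : X (b j) = a j; last exact: Fid.
  have S n : (j < n)%N -> \sum_(0 <= i < n) dot (b j) (b i) *: a i = a j.
    move=> jn; rewrite big_mkord (bigD1 (Ordinal jn)) //= big1 ?addr0.
      by rewrite (sqE Hdot) z1 scale1r.
    move=> i ij; rewrite ob ?scale0r // => e; move/eqP: ij; apply.
    exact: val_inj.
  by rewrite (seq_lim_const_tail (N := j.+1) _ (Xlim (b j))) ?S // => n jn; rewrite !S.
- by move=> k; rewrite /a Dg z1.
- by move=> k; rewrite /b z1.
- by move=> k l kl; apply: oa => /fgI.
- by move=> k l kl; apply: ob => /fgI.
Qed.

End IntervalVectors.

(** * Ideals of stable nets *)

Section NetIdeals.
Variables (R : realType) (H : completeNormedModType R[i]).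
Variable dot : {dot H for Num.conj}.
Hypothesis Hdot : induces_norm dot.
Variable NN : set (H -> H).
Hypothesis HNN : nest dot NN.
Implicit Types (P Q S : set (H -> H)) (X E F M N : H -> H).
Implicit Types (Omega : set (set (H -> H))).

Lemma refines_refl P : refines dot P P.
Proof. by move=> E PE; exists E. Qed.

Lemma refines_trans P Q S : refines dot P Q -> refines dot Q S -> refines dot P S.
Proof.
move=> PQ QS E /PQ[F /QS[G SG FG] EF]; exists G => //.
exact: op_le_trans EF FG.
Qed.

Lemma nest_interval_proj E : nest_interval dot NN E -> orth_projection dot E.
Proof.
move=> [M [N [NM NN' MN ->]]]; apply: (op_leB Hdot) => //; exact: (nestP HNN).
Qed.

Lemma net_filter_cvg0 Omega (f : set (H -> H) -> R) :
  (f @ net_filter dot Omega --> (0 : R)) <->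
  forall e : R, 0 < e -> exists2 P, Omega P &
    forall Q, Omega Q -> refines dot Q P -> `|f Q| < e.
Proof.
split=> [h e e0|h V /nbhs_ballP[e /= e0 eV]].
  have [P OP PV] := h _ (nbhsx_ballx _ _ e0).
  exists P => // Q OQ QP; have := PV Q (conj OQ QP).
  by rewrite /= -ball_normE /= sub0r normrN.
have [P OP PV] := h e e0; exists P => // Q [OQ QP].
by apply: eV; rewrite -ball_normE /= sub0r normrN; exact: PV.
Qed.

Lemma bounded_compression X E : bounded_operator X -> orth_projection dot E ->
  bounded_operator (E \o X \o E).
Proof.
move=> bX [bE _ _].
exact: (bounded_operator_comp (bounded_operator_comp bE bX) bE).
Qed.

Lemma ess_norm_compression_mono X E F : bounded_operator X ->
  orth_projection dot E -> orth_projection dot F -> op_le dot E F ->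
  ess_norm (E \o X \o E) <= ess_norm (F \o X \o F).
Proof.
move=> bX pE pF /(op_leP Hdot pE pF) EF.
have -> : E \o X \o E = E \o (F \o X \o F) \o E.
  by apply/funext => x /=; rewrite (EF x).2 (EF (X (E x))).1.
apply: ess_norm_compress; first by case: pE.
  by move=> x; apply: (proj_norm Hdot).
exact: bounded_compression.
Qed.

Lemma ess_norm_compression_le X E : bounded_operator X -> orth_projection dot E ->
  ess_norm (E \o X \o E) <= op_norm X.
Proof.
move=> bX pE; apply: le_trans (ess_norm_le_op (bounded_compression bX pE)) _.
apply: op_norm_le => x x1 /=; apply: le_trans (proj_norm Hdot _ pE) _.
by apply: op_norm_ub => //; apply: le_trans (proj_norm Hdot _ pE) x1.
Qed.

Lemma sup_ess_norm_has_sup X P : bounded_operator X -> interval_family dot NN P ->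
  has_sup [set ess_norm (E \o X \o E) | E in P].
Proof.
move=> bX [PN [E0 PE0]]; split; first by exists (ess_norm (E0 \o X \o E0)), E0.
exists (op_norm X) => _ [E PE <-]; apply: ess_norm_compression_le => //.
by apply: nest_interval_proj; exact: PN.
Qed.

Lemma ess_norm_le_sup X P E : bounded_operator X -> interval_family dot NN P ->
  P E -> ess_norm (E \o X \o E) <= sup_ess_norm X P.
Proof.
move=> bX fP PE; apply: ub_le_sup; first by case: (sup_ess_norm_has_sup bX fP).
by exists E.
Qed.

Lemma sup_ess_norm_le X P (r : R) : P !=set0 ->
  (forall E, P E -> ess_norm (E \o X \o E) <= r) -> sup_ess_norm X P <= r.
Proof.
move=> [E0 PE0] h; apply: ge_sup; last by move=> _ [E PE <-]; exact: h.
by exists (ess_norm (E0 \o X \o E0)), E0.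
Qed.

Lemma sup_ess_norm_ge0 X P : bounded_operator X -> interval_family dot NN P ->
  0 <= sup_ess_norm X P.
Proof.
move=> bX fP; have [PN [E PE]] := fP; apply: le_trans (ess_norm_le_sup bX fP PE).
by apply/ess_norm_ge0/(bounded_compression bX)/nest_interval_proj/PN.
Qed.

Lemma sup_ess_norm_mono X P Q : bounded_operator X -> interval_family dot NN P ->
  interval_family dot NN Q -> refines dot P Q ->
  sup_ess_norm X P <= sup_ess_norm X Q.
Proof.
move=> bX fP fQ PQ; have [PN P0] := fP; have [QN _] := fQ.
apply: sup_ess_norm_le => // E PE; have [F QF EF] := PQ E PE.
apply: le_trans (ess_norm_le_sup bX fQ QF).
by apply: ess_norm_compression_mono => //; apply: nest_interval_proj; [exact: PN | exact: QN].
Qed.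

(** A family of [Omega2] with small supremum passes the bound on to any refinement, in particular to
    one in [Omega1]. *)
Lemma net_ideal_cofinal Omega1 Omega2 : interval_net dot NN Omega1 ->
  interval_net dot NN Omega2 -> cofinal_in dot Omega1 Omega2 ->
  net_ideal dot NN Omega2 `<=` net_ideal dot NN Omega1.
Proof.
move=> [f1 _ _] [f2 _ _] cof X [AX /net_filter_cvg0 X0]; split=> //.
have [bX _] := AX.
apply/net_filter_cvg0 => e /X0[Q OQ hQ]; have [P OP PQ] := cof Q OQ.
exists P => // P' OP' PP'; have := hQ Q OQ (@refines_refl Q).
apply: le_lt_trans; rewrite !ger0_norm; try by apply: sup_ess_norm_ge0; auto.
by apply: sup_ess_norm_mono; auto; exact: refines_trans PQ.
Qed.

Variable nu : R -> H -> H.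
Hypothesis Hnu : nest_param dot NN nu.

Lemma nest_interval_nu E : nest_interval dot NN E ->
  exists s t, [/\ 0 <= s, s <= t, t <= 1 & E = nu t \- nu s].
Proof.
move=> [M [N [NM NN' MN ->]]]; have [_ _ _ _ [_ onto]] := Hnu.
have [s [s0 s1 es]] := onto M NM; have [t [t0 t1 et]] := onto N NN'.
exists s, t; rewrite es et; split=> //.
by apply: (nu_le_inv Hdot HNN Hnu) => //; rewrite es et.
Qed.

Lemma interval_le s t a b : 0 <= a -> a <= s -> s <= t -> t <= b -> b <= 1 ->
  op_le dot (nu t \- nu s) (nu b \- nu a).
Proof.
move=> a0 as_ st tb b1 x /=; rewrite !dotDl !dotNl lerB //.
  by apply: (nu_le Hnu); lra.
by apply: (nu_le Hnu); lra.
Qed.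

(** Conjugation of [f] by the parametrization [nu]. *)
Lemma order_iso_of_unit_iso f : unit_iso f -> exists theta,
  order_iso dot NN theta /\ forall t, 0 <= t -> t <= 1 -> theta (nu t) = nu (f t).
Proof.
move=> fi; have [f0 f1 fm fs] := fi; have [_ _ nuN nule [nune onto]] := Hnu.
have fle s t : 0 <= s -> t <= 1 -> s <= t -> f s <= f t.
  move=> s0 t1; rewrite le_eqVlt => /predU1P[->|st]; first exact: lexx.
  by apply: ltW; exact: fm.
have f01 t : 0 <= t -> t <= 1 -> 0 <= f t /\ f t <= 1.
  by move=> t0 t1; split; [rewrite -f0 | rewrite -f1]; apply: fle => //; lra.
have /choice[inv invP] : forall N, exists t, NN N -> [/\ 0 <= t, t <= 1 & nu t = N].
  move=> N; have [/onto[t tP]|nN] := pselect (NN N); first by exists t.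
  by exists 0.
have nuinj s t : 0 <= s -> s <= 1 -> 0 <= t -> t <= 1 -> nu s = nu t -> s = t.
  move=> s0 s1 t0 t1 e; apply/eqP; rewrite eq_le; apply/andP; split.
    by apply: (nu_le_inv Hdot HNN Hnu) => //; rewrite e.
  by apply: (nu_le_inv Hdot HNN Hnu) => //; rewrite e.
have thE t : 0 <= t -> t <= 1 -> nu (f (inv (nu t))) = nu (f t).
  move=> t0 t1; have [i0 i1 ie] := invP _ (nuN t t0 t1).
  by rewrite (nuinj _ _ i0 i1 t0 t1 ie).
exists (fun N => nu (f (inv N))); split=> //; split; first split.
- move=> N NN'; have [i0 i1 ie] := invP _ NN'.
  by have [? ?] := f01 _ i0 i1; exact: nuN.
- move=> M N /set_mem NM /set_mem NN'.
  have [i0 i1 ie] := invP _ NM; have [j0 j1 je] := invP _ NN'.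
  have [fi0 fi1] := f01 _ i0 i1; have [fj0 fj1] := f01 _ j0 j1.
  move=> /(nuinj _ _ fi0 fi1 fj0 fj1) e; rewrite -ie -je; congr nu.
  apply/eqP; rewrite eq_le; apply/andP.
  by split; apply: (unit_iso_leW fi) => //; rewrite e.
- move=> N /onto[t [t0 t1 <-]]; have [s [s0 s1 <-]] := fs t t0 t1.
  by exists (nu s); [exact: nuN | rewrite thE].
move=> M N NM NN'; have [i0 i1 ie] := invP _ NM; have [j0 j1 je] := invP _ NN'.
have [fi0 fi1] := f01 _ i0 i1; have [fj0 fj1] := f01 _ j0 j1.
rewrite -{1}ie -{1}je; split=> h.
  by apply: nule => //; apply: fle => //; exact: (nu_le_inv Hdot HNN Hnu).
apply: nule => //; apply: (unit_iso_leW fi) => //.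
exact: (nu_le_inv Hdot HNN Hnu).
Qed.

Definition index_intervals Q (a b : R) :=
  [/\ 0 <= a, a <= b, b <= 1 & Q (nu b \- nu a)].

(** Induction on [n]: stability puts the image of [Q] under the next isomorphism into [Omega], and
    directedness gives a common refinement with the family found so far. Strictness of [a < b] lets
    the order of intervals be read off from their ends. *)
Lemma stable_net_refine Omega Q n (L : nat -> R -> R) : stable_net dot NN Omega ->
  Omega Q -> (forall i, (i < n)%N -> unit_iso (L i)) ->
  exists2 S, Omega S & forall a b, 0 <= a -> a < b -> b <= 1 -> S (nu b \- nu a) ->
    forall i, (i < n)%N -> fits (image_intervals (L i) (index_intervals Q)) a b.
Proof.
move=> [[fam _ dir] stab] OQ; have [_ _ nuN nule [nune _]] := Hnu.
elim: n => [|n IH] Liso; first by exists Q.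
have [|S OS HS] := IH; first by move=> i ni; apply: Liso; exact: ltnW.
have [theta [thi thE]] := order_iso_of_unit_iso (Liso n (ltnSn n)).
have [f0 f1 fm _] := Liso n (ltnSn n).
have [S' [OS' S'S S'Q]] := dir _ _ OS (stab _ _ thi OQ).
exists S' => // a b a0 ab b1 S'ab i; rewrite ltnS leq_eqVlt => /predU1P[->|ni].
  have [_ [M [N [NM NN' MN QMN ->]]] le] := S'Q _ S'ab.
  have [_ _ _ _ [_ onto]] := Hnu.
  have [a' [a'0 a'1 ea]] := onto M NM; have [b' [b'0 b'1 eb]] := onto N NN'.
  rewrite -ea -eb in MN QMN le; rewrite !thE // in le.
  have ab' : a' <= b' by exact: (nu_le_inv Hdot HNN Hnu).
  have fle s t : 0 <= s -> t <= 1 -> s <= t -> L n s <= L n t.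
    move=> s0 t1; rewrite le_eqVlt => /predU1P[->|st]; first exact: lexx.
    by apply: ltW; exact: fm.
  have fa0 : 0 <= L n a' by rewrite -f0; apply: fle.
  have fb1 : L n b' <= 1 by rewrite -f1; apply: fle.
  have fab : L n a' <= L n b' by exact: fle.
  have a1 : a <= 1 by lra.
  have b0 : 0 <= b by lra.
  have [|||||||h1 h2] := op_le_endpoints Hdot HNN _ _ _ _ _ _ _ le.
  - by apply: nuN => //; lra.
  - by apply: nuN => //; lra.
  - exact: nuN.
  - exact: nuN.
  - exact: nule.
  - by apply: nule => //; exact: ltW.
  - exact: nune.
  exists (L n a'), (L n b'); split; first by exists a', b'.
    by apply: (nu_le_inv Hdot HNN Hnu) => //; lra.
  by apply: (nu_le_inv Hdot HNN Hnu) => //; lra.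
have [F SF le] := S'S _ S'ab.
have [s [t [s0 st t1 eF]]] := nest_interval_nu ((fam _ OS).1 _ SF).
rewrite eF in SF le.
have [|||||||h1 h2] := op_le_endpoints Hdot HNN _ _ _ _ _ _ _ le.
- by apply: nuN; lra.
- by apply: nuN; lra.
- by apply: nuN; lra.
- by apply: nuN; lra.
- exact: nule.
- by apply: nule => //; exact: ltW.
- exact: nune.
have {h1} sa : s <= a by apply: (nu_le_inv Hdot HNN Hnu) => //; lra.
have {h2} bt : b <= t by apply: (nu_le_inv Hdot HNN Hnu) => //; lra.
have st' : s < t by lra.
exact: (fitsW sa bt (HS s t s0 st' t1 SF i ni)).
Qed.

Lemma net_ideal_separation Omega1 Omega2 Q : interval_net dot NN Omega1 ->
  stable_net dot NN Omega2 -> Omega2 Q ->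
  (forall P, Omega1 P -> ~ refines dot P Q) ->
  exists2 X, net_ideal dot NN Omega2 X & ~ net_ideal dot NN Omega1 X.
Proof.
move=> [fam1 _ _] st2 OQ nref; have [[fam2 _ _] _] := st2.
have subQ : subunit (index_intervals Q) by move=> a b [].
have [n [L [T [[Liso Tc Tv Tfin] Tinf]]]] := test_system_ex subQ.
have [X [AX Xcomp Xess]] := separating_operator Hdot HNN Hnu Tc Tv.
have [bX _] := AX.
have [S OS HS] := stable_net_refine st2 OQ Liso.
exists X.
  (* All compressions to members of [S] are compact, so the supremum is 0 for every family that
     refines [S]. *)
  split=> //; apply/net_filter_cvg0 => e e0; exists S => // P OP PS.
  suff -> : sup_ess_norm X P = 0 by rewrite normr0.
  have fP := fam2 _ OP; have fS := fam2 _ OS.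
  apply/eqP; rewrite eq_le (sup_ess_norm_ge0 bX fP) andbT.
  apply: le_trans (sup_ess_norm_mono bX fP fS PS) _.
  apply: sup_ess_norm_le => [|F SF]; first by case: fS.
  have [a [b [a0 ab b1 eF]]] := nest_interval_nu (fS.1 _ SF).
  rewrite ess_norm_compact // eF; move: ab; rewrite le_eqVlt => /predU1P[->|ab].
    rewrite (_ : _ \o _ = \0); first exact: compact_operator0.
    by apply/funext => x /=; rewrite subrr.
  apply: Xcomp => //; first exact: ltW.
  by apply: Tfin => // i ni; apply: HS => //; rewrite -eF.
move=> [_ /net_filter_cvg0 X0]; have [P OP hP] := X0 1 ltr01.
have fP := fam1 _ OP.
(* A [Q]-bad interval in a family on which the supremum is below 1, although the compression to it
   has essential norm at least 1. *)
have [E PE nE] : exists2 E, P E & forall F, Q F -> ~ op_le dot E F.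
  apply: contrapT => h; apply: (nref P OP) => E PE; apply: contrapT => hE.
  by apply: h; exists E => // F QF EF; apply: hE; exists F.
have [s [t [s0 st t1 eE]]] := nest_interval_nu (fP.1 _ PE).
have nfit : ~ fits (index_intervals Q) s t.
  move=> [a [b [[a0 ab b1 Qab] as_ tb]]]; apply: (nE _ Qab); rewrite eE.
  exact: interval_le.
(* The zero interval lies under every member of the nonempty [Q], so it is not bad. *)
have {}st : s < t.
  rewrite lt_neqAle st andbT; apply/eqP => e.
  have [QN [F QF]] := fam2 _ OQ; apply: (nE _ QF) => x; rewrite eE e /= subrr dot0l.
  by rewrite (proj_dot Hdot x (nest_interval_proj (QN _ QF))) lecR sq_ge0.
have := hP P OP (@refines_refl P).
rewrite ger0_norm ?(sup_ess_norm_ge0 bX fP) // ltNge => /negP; apply.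
apply: le_trans (ess_norm_le_sup bX fP PE); rewrite eE.
by apply: Xess => //; [exact: ltW | exact: Tinf].
Qed.

End NetIdeals.

Theorem theorem4p1 (R : realType) (H : completeNormedModType R[i])
    (dot : {dot H for Num.conj}) (Hdot : induces_norm dot)
    (Hsep : separable H)
    (NN : set (H -> H)) (HNN : continuous_nest dot NN)
    (Omega1 Omega2 : set (set (H -> H)))
    (HOmega1 : stable_net dot NN Omega1)
    (HOmega2 : stable_net dot NN Omega2) :
  net_ideal dot NN Omega2 `<=` net_ideal dot NN Omega1 <->
  cofinal_in dot Omega1 Omega2.
Proof.
have [nNN _] := HNN; have [net1 _] := HOmega1; have [net2 _] := HOmega2.
split=> [sub Q OQ|]; last exact: net_ideal_cofinal.
apply: contrapT => nP.
have nref P : Omega1 P -> ~ refines dot P Q by move=> OP PQ; apply: nP; exists P.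
(* On the zero space all operators are comparable, so every family would refine [Q]. *)
have Hnz : exists x : H, x <> 0.
  apply: contrapT => /forallNP h; have [_ [P OP] _] := net1.
  have [fam2 _ _] := net2; have [_ [F QF]] := fam2 _ OQ.
  apply: (nref P OP) => E PE; exists F => // x.
  by rewrite (contrapT (h x)) !dot0r.
have [nu Hnu] := nest_param_ex Hdot Hsep HNN Hnz.
have [X X2 X1] := net_ideal_separation Hdot nNN Hnu net1 HOmega2 OQ nref.
by apply: X1; exact: sub.
Qed.
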